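(* Let $T$ be a complete first-order theory. The group $\mathrm{Gal}_0(T)$ is the quotient of a compact, Hausdorff group by a dense subgroup. More precisely, let $\bar f\colon u\mathcal{M}/H(u\mathcal{M})\to\mathrm{Gal}_L(T)$ be the continuous epimorphism defined in the context, put $Y:=\ker(\bar f)$, and let $\mathrm{cl}_\tau(Y)$ be its closure inside the compact Hausdorff group $u\mathcal{M}/H(u\mathcal{M})$. Then $\bar f[\mathrm{cl}_\tau(Y)]=\mathrm{Gal}_0(T)$, so $\bar f$ restricted to $\mathrm{cl}_\tau(Y)$ induces an isomorphism between $\mathrm{cl}_\tau(Y)/Y$ and $\mathrm{Gal}_0(T)$.
   Context: ''Compact'' does not include Hausdorff. A monster model is a model that is $\kappa$-saturated and strongly $\kappa$-homogeneous for a sufficiently large strong limit cardinal $\kappa$ (its degree of saturation); ''small'' means of cardinality less than the degree of saturation. $\mathfrak{C}$ is a monster model of $T$, $\bar c$ is a tuple enumerating all elements of $\mathfrak{C}$, and $\mathfrak{C}'\succ\mathfrak{C}$ is a bigger monster model whose degree of saturation is much bigger than $|\mathfrak{C}|$. Put $S_{\bar c}(\mathfrak{C})=\{\mathrm{tp}(\bar a/\mathfrak{C}) : \bar a\equiv\bar c\}$ ($\bar a$ from $\mathfrak{C}'$), a compact Hausdorff space on which $\mathrm{Aut}(\mathfrak{C})$ acts naturally. $EL$ is the Ellis semigroup of this action: the closure of $\mathrm{Aut}(\mathfrak{C})$ (each automorphism viewed as a map $S_{\bar c}(\mathfrak{C})\to S_{\bar c}(\mathfrak{C})$) in the product space $S_{\bar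 c}(\mathfrak{C})^{S_{\bar c}(\mathfrak{C})}$, with composition as semigroup operation; $\mathrm{Aut}(\mathfrak{C})$ is regarded as a subset of $EL$. $\mathcal{M}$ is any minimal left ideal of $EL$ and $u\in\mathcal{M}$ any idempotent; then $u\mathcal{M}$ is a group with identity $u$ (the Ellis group). For $A\subseteq EL$ and $p\in EL$, $p\circ A$ is the set of all $\eta\in EL$ for which there are nets $(\eta_i)$ in $A$ and $(g_i)$ in $\mathrm{Aut}(\mathfrak{C})$ with $\lim g_i=p$ and $\lim g_i\eta_i=\eta$. For $A\subseteq u\mathcal{M}$, $\mathrm{cl}_\tau(A)=(u\circ A)\cap u\mathcal{M}$; this is a closure operator which defines the $\tau$-topology on $u\mathcal{M}$ (it is compact, $T_1$, and multiplication is separately continuous). $H(u\mathcal{M})$ is the intersection of the sets $\mathrm{cl}_\tau(V)$ over all $\tau$-neighborhoods $V$ of $u$; it is a $\tau$-closed normal subgroup of $u\mathcal{M}$, and $u\mathcal{M}/H(u\mathcal{M})$ with the quotient topology (also called the $\tau$-topology) is a compact Hausdorff group. Galois groups (computed in $\mathfrak{C}'$): $\mathrm{Autf}_L(\mathfrak{C}')$ is the (normal) subgroup of $\mathrm{Aut}(\mathfrak{C}')$ generated by all automorphisms fixing pointwise some small submodel; $\mathrm{Gal}_L(T)=\mathrm{Aut}(\mathfrak{C}')/\mathrm{Autf}_L(\mathfrak{C}')$. Its topology: for a small model $M$ enumerated by $\bar m$, $\mathrm{Gal}_L(T)$ carries the quotient topology from the map $S_{\bar m}(M)\to\mathrm{Gal}_L(T)$,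 $\mathrm{tp}(\sigma(\bar m)/M)\mapsto\sigma\,\mathrm{Autf}_L(\mathfrak{C}')$ (well defined and independent of $M$); it is a compact, not necessarily Hausdorff, topological group. $\mathrm{Gal}_0(T)$ is the closure of the identity in $\mathrm{Gal}_L(T)$. For $x\in EL$ let $\pi_0(x)=x(\mathrm{tp}(\bar c/\mathfrak{C}))\in S_{\bar c}(\mathfrak{C})$. The map $\hat f\colon EL\to\mathrm{Gal}_L(T)$ is $\hat f(x)=\sigma'\,\mathrm{Autf}_L(\mathfrak{C}')$, where $\sigma'\in\mathrm{Aut}(\mathfrak{C}')$ is any automorphism with $\sigma'(\bar c)\models\pi_0(x)$ (well defined, a semigroup epimorphism). $f=\hat f|_{u\mathcal{M}}$ is a group epimorphism which is trivial on $H(u\mathcal{M})$, and $\bar f\colon u\mathcal{M}/H(u\mathcal{M})\to\mathrm{Gal}_L(T)$, $\bar f(pH(u\mathcal{M}))=f(p)$, is the induced continuous epimorphism. *)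

(* Defs.v *)
From HB Require Import structures.
From mathcomp Require Import all_boot all_classical.
From mathcomp Require Import finmap topology.

Set Implicit Arguments.
Unset Strict Implicit.
Unset Printing Implicit Defensive.
Set Warnings "-redundant-canonical-projection".

Local Open Scope classical_set_scope.
Local Open Scope card_scope.
Local Open Scope quotient_scope.

Record language := Language {
  fn : Type;
  fn_arity : fn -> nat;
  rl : Type;
  rl_arity : rl -> nat }.

(* Free variables are drawn from an arbitrary type [X], so that a type in a
   tuple of variables indexed by [X] with parameters indexed by [A] is a set of
   formulas over [X + A]. A quantifier binds the extra variable [None]. *)
Inductive term (L : language) (X : Type) : Type :=
| Var of X
| App (f : fn L) of ('I_(fn_arity f) -> term L X).

Inductive formula (L : language) (X : Type) : Type :=
| Eqn of term L X & term L X
| Rel (r : rl L) of ('I_(rl_arity r) -> term L X)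
| Bot
| Imp of formula L X & formula L X
| All of formula L (option X).

Arguments Bot {L X}.

Record structure (L : language) := Structure {
  carrier :> Type;
  fn_int : forall f : fn L, ('I_(fn_arity f) -> carrier) -> carrier;
  rl_int : forall r : rl L, ('I_(rl_arity r) -> carrier) -> Prop;
  carrier_inh : inhabited carrier }.

Arguments fn_int {L s} f _.
Arguments rl_int {L s} r _.

Section semantics.
Context {L : language}.

Fixpoint eval (M : structure L) X (v : X -> M) (t : term L X) : M :=
  match t with
  | Var x => v x
  | App f ts => fn_int f (fun i => eval v (ts i))
  end.

Fixpoint sat (M : structure L) X (v : X -> M) (phi : formula L X) : Prop :=
  match phi with
  | Eqn t1 t2 => eval v t1 = eval v t2
  | Rel r ts => rl_int r (fun i => eval v (ts i))
  | Bot => False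
  | Imp p q => sat v p -> sat v q
  | All p => forall a : M, sat (oapp v a) p
  end.

Fixpoint trename X Y (h : X -> Y) (t : term L X) : term L Y :=
  match t with
  | Var x => Var L (h x)
  | App f ts => App (fun i => trename h (ts i))
  end.

Fixpoint rename X Y (h : X -> Y) (phi : formula L X) : formula L Y :=
  match phi with
  | Eqn t1 t2 => Eqn (trename h t1) (trename h t2)
  | Rel r ts => Rel (fun i => trename h (ts i))
  | Bot => Bot
  | Imp p q => Imp (rename h p) (rename h q)
  | All p => All (rename (omap h) p)
  end.

Lemma eval_trename (M : structure L) X Y (h : X -> Y) (v : Y -> M) t :
  eval v (trename h t) = eval (v \o h) t.
Proof. by elim: t => //= f ts IH; congr fn_int; apply/funext. Qed.

Lemma sat_rename (M : structure L) X (phi : formula L X) :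
  forall Y (h : X -> Y) (v : Y -> M),
  sat v (rename h phi) <-> sat (v \o h) phi.
Proof.
elim: phi => {X} //= [X t1 t2|X r ts|X p IHp q IHq|X p IH] Y h v.
- by rewrite !eval_trename.
- by under eq_fun do rewrite eval_trename.
- by rewrite IHp IHq.
- suff E a : oapp v a \o omap h = oapp (v \o h) a.
    split=> H a; first by rewrite -E; exact: (IH _ _ _).1.
    by apply: (IH _ _ _).2; rewrite E.
  by apply/funext => -[].
Qed.

Definition theory := set (formula L void).

Definition models (M : structure L) (T : theory) : Prop :=
  forall phi, T phi -> sat (of_void M) phi.

Definition entails (T : theory) (phi : formula L void) : Prop :=
  forall M : structure L, models M T -> sat (of_void M) phi.

Definition complete_theory (T : theory) : Prop :=
  (exists M : structure L, models M T) /\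
  forall phi, entails T phi \/ entails T (Imp phi Bot).

(* [same_type a b] is the relation a ≡ b between tuples with the same index set,
   possibly in two different structures. *)
Definition same_type (M N : structure L) X (a : X -> M) (b : X -> N) : Prop :=
  forall phi : formula L X, sat a phi <-> sat b phi.

(* The tuple enumerating [M] by itself is [id], hence [emb] is elementary iff
   it has the type of [id]. *)
Record elem_embedding (M N : structure L) := ElemEmbedding {
  emb :> M -> N;
  embP : same_type (@id M) emb }.

Definition sum_val (M : Type) X A (a : X -> M) (b : A -> M) (z : X + A) : M :=
  match z with inl x => a x | inr y => b y end.

(* tp(a / b), with [X] the variables and [A] the parameters. *)
Definition tp (N : structure L) X A (a : X -> N) (b : A -> N) :
  set (formula L (X + A)) := [set phi | sat (sum_val a b) phi].

Record aut (M : structure L) := Aut {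
  aut_fun :> M -> M;
  aut_inv : M -> M;
  aut_funK : cancel aut_fun aut_inv;
  aut_invK : cancel aut_inv aut_fun;
  aut_fn : forall f ts, aut_fun (fn_int f ts) = fn_int f (aut_fun \o ts);
  aut_rl : forall r ts, rl_int r ts <-> rl_int r (aut_fun \o ts) }.

Section aut_group.
Context {M : structure L}.

Lemma autP (g h : aut M) : aut_fun g = aut_fun h -> g = h.
Proof.
case: g h => [g g' gK g'K gf gr] [h h' hK h'K hf hr] /= E.
rewrite -{}E in hK h'K hf hr *.
have E : g' = h' by apply/funext => x; rewrite -[in LHS](h'K x) gK.
rewrite -{}E in hK h'K *; rewrite (Prop_irrelevance hK gK).
rewrite (Prop_irrelevance h'K g'K) (Prop_irrelevance hf gf).
by rewrite (Prop_irrelevance hr gr).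
Qed.

Lemma aut_eval (g : aut M) X (v : X -> M) t : g (eval v t) = eval (g \o v) t.
Proof.
elim: t => //= f ts IH; rewrite aut_fn; congr fn_int; exact/funext.
Qed.

Lemma aut_sat (g : aut M) X (phi : formula L X) :
  forall v : X -> M, sat v phi <-> sat (g \o v) phi.
Proof.
elim: phi => {X} //= [X t1 t2|X r ts|X p IHp q IHq|X p IH] v.
- by rewrite -!aut_eval; split=> [->//|/(can_inj (aut_funK g))].
- suff -> : (fun i => eval (g \o v) (ts i)) = g \o (fun i => eval v (ts i)).
    exact: aut_rl.
  by apply/funext => i /=; rewrite aut_eval.
- by rewrite IHp IHq.
- have E a : oapp (g \o v) (g a) = g \o oapp v a by apply/funext => -[].
  split=> H a; last by apply: (IH _).2; rewrite -E; exact: H.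
  by rewrite -(aut_invK g a) E; exact: (IH _).1.
Qed.

Let id_fn f ts : @id M (fn_int f ts) = fn_int f (id \o ts).
Proof. by []. Qed.
Let id_rl r ts : rl_int r ts <-> rl_int r (@id M \o ts).
Proof. by []. Qed.

Definition aut1 : aut M :=
  @Aut M id id (fun=> erefl) (fun=> erefl) id_fn id_rl.

Let inv_fn (g : aut M) f ts :
  aut_inv g (fn_int f ts) = fn_int f (aut_inv g \o ts).
Proof.
apply: (can_inj (aut_funK g)); rewrite aut_invK aut_fn; congr fn_int.
by apply/funext => i /=; rewrite aut_invK.
Qed.
Let inv_rl (g : aut M) r ts : rl_int r ts <-> rl_int r (aut_inv g \o ts).
Proof.
rewrite [in X in _ <-> X](aut_rl g); suff E : g \o (aut_inv g \o ts) = ts by rewrite E.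
by apply/funext => i /=; rewrite aut_invK.
Qed.

Definition autV (g : aut M) : aut M :=
  Aut (aut_invK g) (aut_funK g) (inv_fn g) (inv_rl g).

Let mul_fn (g h : aut M) f ts :
  (g \o h) (fn_int f ts) = fn_int f ((g \o h) \o ts).
Proof. by rewrite /= !aut_fn. Qed.
Let mul_rl (g h : aut M) r ts : rl_int r ts <-> rl_int r ((g \o h) \o ts).
Proof. by rewrite (aut_rl h) (aut_rl g). Qed.

Definition autM (g h : aut M) : aut M :=
  Aut (can_comp (aut_funK g) (aut_funK h)) (can_comp (aut_invK h) (aut_invK g))
    (mul_fn g h) (mul_rl g h).

HB.instance Definition _ := gen_eqMixin (aut M).
HB.instance Definition _ := gen_choiceMixin (aut M).

Let autMA : associative autM. Proof. by move=> f g h; exact: autP. Qed.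
Let aut1M : left_id aut1 autM. Proof. by move=> g; exact: autP. Qed.
Let autM1 : right_id aut1 autM. Proof. by move=> g; exact: autP. Qed.
Let autVM : left_inverse aut1 autV autM.
Proof. by move=> g; apply: autP; apply/funext => x; exact: aut_funK. Qed.
Let autMV : right_inverse aut1 autV autM.
Proof. by move=> g; apply: autP; apply/funext => x; exact: aut_invK. Qed.

HB.instance Definition _ :=
  isGroup.Build (aut M) autMA aut1M autM1 autVM autMV.

End aut_group.

(* A cardinal is given by a type of that cardinality. *)

Definition card_lt (A B : Type) : Prop :=
  [set: A] #<= [set: B] /\ ~ ([set: B] #<= [set: A]).

Definition strong_limit (K : Type) : Prop :=
  infinite_set [set: K] /\
  forall X : set K, card_lt X K -> card_lt (set X) K.

Definition saturated (K : Type) (M : structure L) : Prop :=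
  forall (A : set M) (p : set (formula L (unit + A))), card_lt A K ->
    (forall F, finite_set F -> F `<=` p ->
       exists x : M, forall phi, F phi -> sat (sum_val (fun=> x) set_val) phi) ->
    exists x : M, forall phi, p phi -> sat (sum_val (fun=> x) set_val) phi.

Definition strongly_homogeneous (K : Type) (M : structure L) : Prop :=
  forall (A : set M) (f : A -> M), card_lt A K ->
    same_type (set_val : A -> M) f ->
    exists g : aut M, forall a : A, g (set_val a) = f a.

(* [formula L nat] has cardinality |L| + aleph_0. *)
Record monster (T : theory) (K : Type) (M : structure L) : Prop := Monster {
  monster_models : models M T;
  monster_large : card_lt (formula L nat) K;
  monster_limit : strong_limit K;
  monster_sat : saturated K M;
  monster_hom : strongly_homogeneous K M }.

(* [tpspace e] is the space of the types tp(a / e) with a ≡ e. *)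
Section tpspace.
Context {N : structure L} {A : Type}.

Record tpspace (e : A -> N) := TpSpace {
  tp_set :> set (formula L (A + A));
  tp_setP : exists2 a : A -> N, same_type a e & tp_set = tp a e }.

HB.instance Definition _ X := gen_eqMixin (formula L X).
HB.instance Definition _ X := gen_choiceMixin (formula L X).
HB.instance Definition _ X := isPointed.Build (formula L X) Bot.
HB.instance Definition _ e := gen_eqMixin (tpspace e).
HB.instance Definition _ e := gen_choiceMixin (tpspace e).
HB.instance Definition _ e := @isSubBaseTopological.Build (tpspace e)
  (formula L (A + A)) setT (fun phi => [set p : tpspace e | tp_set p phi]).

Lemma tpspace_eq (e : A -> N) (p q : tpspace e) : tp_set p = tp_set q -> p = q.
Proof.
case: p q => [p pP] [q qP] /= E; rewrite -{}E in qP *.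
by rewrite (Prop_irrelevance qP pP).
Qed.

Lemma open_tp (e : A -> N) phi : open [set p : tpspace e | tp_set p phi].
Proof.
rewrite openE => p pphi; exists [set p : tpspace e | tp_set p phi].
split=> //; exists [set [set p : tpspace e | tp_set p phi]]; last first.
  by rewrite bigcup_set1.
by move=> _ ->; exact: (finI_from1 (fun psi => [set p | tp_set p psi])).
Qed.

Let tp_refl_subproof (e : A -> N) :
  exists2 a : A -> N, same_type a e & tp e e = tp a e.
Proof. by exists e. Qed.

Definition tp_refl (e : A -> N) : tpspace e := TpSpace (tp_refl_subproof e).

End tpspace.
End semantics.

Arguments theory : clear implicits.

(* A group and a topology on the same type, without any compatibility. *)
HB.structure Definition TGroup := {G of Topological G & Group G}.

Section groups.
Context {G : groupType}.
Local Open Scope group_scope.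

Definition subgroup (N : set G) : Prop :=
  [/\ N 1, forall x y, N x -> N y -> N (x * y) & forall x, N x -> N x^-1].

Definition normal (N : set G) : Prop :=
  subgroup N /\ forall g x, N x -> N (g * x * g^-1).

Record normal_subgroup := NormalSubgroup {
  nset :> set G;
  nsetP : normal nset }.

Context (N : normal_subgroup).

Definition coset_rel : rel G := fun x y => `[< nset N (x^-1 * y) >].

Lemma coset_refl : reflexive coset_rel.
Proof. by move=> x; apply/asboolP; rewrite mulVg; case: (nsetP N) => -[]. Qed.

Lemma coset_sym : symmetric coset_rel.
Proof.
have [[_ _ NV] _] := nsetP N.
by move=> x y; apply/asboolP/asboolP => /NV; rewrite invgM invgK.
Qed.

Lemma coset_trans : transitive coset_rel.
Proof.
have [[_ NM _] _] := nsetP N.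
move=> y x z /asboolP xy /asboolP yz; apply/asboolP.
by have := NM _ _ xy yz; rewrite mulgA mulgK.
Qed.

Definition coset_equiv := EquivRel coset_rel coset_refl coset_sym coset_trans.

Definition quot : Type := {eq_quot coset_equiv}.

HB.instance Definition _ := Choice.on quot.
HB.instance Definition _ := Quotient.on quot.

Lemma quot_eqP (x y : G) : \pi_quot x = \pi_quot y <-> nset N (x^-1 * y).
Proof.
split=> [/eqmodP/asboolP//|H]; apply/(@eqmodP _ coset_equiv); exact/asboolP.
Qed.

Definition quot1 : quot := \pi_quot 1.
Definition quotV (a : quot) : quot := \pi_quot ((repr a)^-1).
Definition quotM (a b : quot) : quot := \pi_quot (repr a * repr b).

Lemma piM (x y : G) : quotM (\pi_quot x) (\pi_quot y) = \pi_quot (x * y).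
Proof.
have [[_ NM _] NJ] := nsetP N.
have /quot_eqP Nx := reprK (\pi_quot x); have /quot_eqP Ny := reprK (\pi_quot y).
apply/quot_eqP; set x' := repr _ in Nx *; set y' := repr _ in Ny *.
have := NM _ _ (NJ y'^-1 _ Nx) Ny.
by rewrite invgK invgM !mulgA mulgK.
Qed.

Lemma piV (x : G) : quotV (\pi_quot x) = \pi_quot (x^-1).
Proof.
have [[_ _ NV] NJ] := nsetP N.
have /quot_eqP Nx := reprK (\pi_quot x).
apply/quot_eqP; set x' := repr _ in Nx *.
have Hx := NJ x' _ (NV _ Nx); rewrite invgM !invgK mulgA mulgK in Hx.
by rewrite invgK.
Qed.

Let quotMA : associative quotM.
Proof.
elim/quotW=> x; elim/quotW=> y; elim/quotW=> z.
by rewrite (piM x y) (piM y z) !piM mulgA.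
Qed.
Let quot1M : left_id quot1 quotM.
Proof. by elim/quotW=> x; rewrite piM mul1g. Qed.
Let quotM1 : right_id quot1 quotM.
Proof. by elim/quotW=> x; rewrite piM mulg1. Qed.
Let quotVM : left_inverse quot1 quotV quotM.
Proof. by elim/quotW=> x; rewrite piV piM mulVg. Qed.
Let quotMV : right_inverse quot1 quotV quotM.
Proof. by elim/quotW=> x; rewrite piV piM mulgV. Qed.

HB.instance Definition _ := isGroup.Build quot quotMA quot1M quotM1 quotVM quotMV.

End groups.

Arguments normal_subgroup : clear implicits.

Section quotient_topology.
Context {G : TGroup.type} (N : normal_subgroup G).

Definition quot_open : set_system (quot N) :=
  [set U | open (\pi_(quot N) @^-1` U)].

Let quot_openT : quot_open setT.
Proof. exact: openT. Qed.
Let quot_openI : setI_closed quot_open.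
Proof. by move=> U V; exact: openI. Qed.
Let quot_open_bigU I (U : I -> set (quot N)) :
  (forall i, quot_open (U i)) -> quot_open (\bigcup_i U i).
Proof.
move=> oU; rewrite /quot_open /= preimage_bigcup.
by apply: bigcup_open => i _; exact: oU.
Qed.

HB.instance Definition _ :=
  isOpenTopological.Build (quot N) quot_openT quot_openI quot_open_bigU.

End quotient_topology.

Section cosets.
Context {G : groupType}.
Local Open Scope group_scope.

Definition coset (x : G) (N : set G) : set G := [set x * y | y in N].

Definition setM (A B : set G) : set G := [set x * y | x in A & y in B].

(* [f] restricted to [K] induces an isomorphism of the group of cosets [K / Y],
   with the product of subsets, onto [R]. *)
Definition induces_iso (Q : groupType) (f : G -> Q) (K Y : set G) (R : set Q) :=
  exists phi : set G -> Q,
  [/\ forall x, K x -> phi (coset x Y) = f x,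
      set_bij [set coset x Y | x in K] R phi
    & forall x y, K x -> K y ->
        phi (setM (coset x Y) (coset y Y)) = phi (coset x Y) * phi (coset y Y)].

End cosets.

Definition compact_hausdorff_group (G : TGroup.type) (K : set G) : Prop :=
  [/\ subgroup K,
      compact [set: K],
      hausdorff_space K,
      continuous (fun z : K * K => (val z.1 * val z.2)%g : G)
    & continuous (fun z : K => (val z)^-1%g : G)].

(* [cbar] is the tuple enumerating C, seen in C'; [degC] and [degC'] are the
   degrees of saturation of C and C'. *)
Record monster_pair (L : language) (T : theory L) := MonsterPair {
  mC : structure L;
  mC' : structure L;
  degC : Type;
  degC' : Type;
  cbar : elem_embedding mC mC';
  mC_monster : monster T degC mC;
  mC'_monster : monster T degC' mC';
  mC_small : card_lt mC degC' }.

Section ellis.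
Context {L : language} {T : theory L} (P : monster_pair T).

Notation C := (mC P).
Notation C' := (mC' P).
Notation c := (cbar P).

Lemma emb_sat (M N : structure L) (e : elem_embedding M N) X (v : X -> M) phi :
  sat v phi <-> sat (e \o v) phi.
Proof.
by have := embP e (rename v phi); rewrite !sat_rename.
Qed.

Lemma emb_inj (M N : structure L) (e : elem_embedding M N) : injective e.
Proof. by move=> x y exy; exact: (embP e (Eqn (Var L x) (Var L y))).2. Qed.

Lemma aut_extend (g : aut C) : exists g' : aut C', forall x, g' (c x) = c (g x).
Proof.
pose A := range c.
have invP (z : A) : exists x, c x = set_val z.
  by have [x _ xE] := set_valP z; exists x.
have [inv invE] := choice invP.
have A_small : card_lt A (degC' P).
  have AC : [set: A] #<= [set: C].
    have inv_inj : set_inj [set: A] inv.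
      move=> x y _ _ xy; apply: eq_sig_hprop => [? ? ?|/=].
        exact: Prop_irrelevance.
      by have := invE x; rewrite xy invE.
    have [f] : $|{injfun [set: A] >-> [set: C]}| by apply/injfunPex; exists inv.
    exact: inj_card_le f.
  have [CK KC] := mC_small P; split; first exact: card_le_trans AC CK.
  by move=> KA; apply: KC; exact: card_le_trans KA AC.
have AE : same_type (set_val : A -> C') (c \o (g \o inv)).
  move=> phi; have -> : (set_val : A -> C') = c \o inv.
    by apply/funext => z /=; rewrite invE.
  by rewrite -!emb_sat; exact: aut_sat.
have [g' g'E] := monster_hom (mC'_monster P) A_small AE.
exists g' => x; pose z : A := SigSub (mem_set (imageT c x)).
by rewrite (g'E z) /=; congr (c (g _)); apply: (@emb_inj _ _ c); rewrite invE.
Qed.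

Definition S_cbar : Type := tpspace c.

HB.instance Definition _ := Topological.on S_cbar.

(* φ(x, b) belongs to g p iff φ(x, g^-1 b) belongs to p. *)
Definition act_rename (g : aut C) (z : C + C) : C + C :=
  match z with inl x => inl x | inr b => inr ((g^-1)%g b) end.

Definition act_set (g : aut C) (p : S_cbar) : set (formula L (C + C)) :=
  [set phi | tp_set p (rename (act_rename g) phi)].

Let act_setP (g : aut C) (p : S_cbar) :
  exists2 a : C -> C', same_type a c & act_set g p = tp a c.
Proof.
have [a ac pE] := tp_setP p; have [g' g'E] := aut_extend g.
exists (g' \o a) => [phi|]; first by rewrite -ac -aut_sat.
apply/funext => phi; apply/propext; rewrite /act_set /= pE /tp /=.
rewrite sat_rename (aut_sat g').
suff -> : g' \o (sum_val a c \o act_rename g) = sum_val (g' \o a) c by [].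
by apply/funext => -[x|b] //=; rewrite g'E; congr (c _); exact: aut_invK.
Qed.

Definition act (g : aut C) (p : S_cbar) : S_cbar := TpSpace (act_setP g p).

(* A directed set and the filter of tails of the nets indexed by it. *)
Definition directed (I : Type) (le : I -> I -> Prop) : Prop :=
  [/\ inhabited I, forall i, le i i,
      forall i j k, le i j -> le j k -> le i k
    & forall i j, exists k, le i k /\ le j k].

Definition tails (I : Type) (le : I -> I -> Prop) : set_system I :=
  [set B | exists i, forall j, le i j -> B j].

Definition selfmap : Type := {ptws S_cbar -> S_cbar}.

HB.instance Definition _ := Topological.on selfmap.

Definition EL : set selfmap := closure [set (act g : selfmap) | g in [set: aut C]].

Definition left_ideal (I : set selfmap) : Prop :=
  [/\ I `<=` EL, I !=set0 & forall x y, EL x -> I y -> I (x \o y)].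

Definition minimal_left_ideal (I : set selfmap) : Prop :=
  left_ideal I /\ forall J, left_ideal J -> J `<=` I -> J = I.

(* p ∘ A; [act] embeds Aut(C) into EL. *)
Definition circ (p : selfmap) (A : set selfmap) : set selfmap :=
  [set eta | EL eta /\
    exists (I : Type) (le : I -> I -> Prop) (x : I -> selfmap) (g : I -> aut C),
    [/\ directed le, forall i, A (x i),
        (act \o g : I -> selfmap) @ tails le --> p
      & (fun i => act (g i) \o x i : selfmap) @ tails le --> eta]].

Record ellis_data := EllisData {
  ideal : set selfmap;
  idem : selfmap;
  idealP : minimal_left_ideal ideal;
  idem_in : ideal idem;
  idemP : idem \o idem = idem }.

Lemma ptws_cvgP (I : Type) (F : set_system I) (f : I -> selfmap) (x : selfmap) :
  Filter F -> (forall p, (fun i => f i p) @ F --> x p) -> f @ F --> x.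
Proof.
move=> FF H; apply/cvg_sup => p.
have surjp (v : S_cbar) : exists h : selfmap, h p = v by exists (fun=> v).
apply/cvg_image; first by apply/seteqP; split=> // v _; have [h] := surjp v; exists h.
move=> W /= /H FW; exists ((fun h : selfmap => h p) @^-1` W); first exact: FW.
by apply/seteqP; split=> [_ [h Wh <-]//|v Wv]; have [h hv] := surjp v;
  exists h => //=; rewrite hv.
Qed.

Lemma compr_continuous (q : selfmap) :
  continuous (fun x : selfmap => (x \o q : selfmap)).
Proof.
move=> x; apply: (ptws_cvgP (nbhs_filter x)) => p.
exact: (@proj_continuous S_cbar (fun=> S_cbar) (q p) x).
Qed.

Lemma act_continuous (g : aut C) : continuous (act g).
Proof.
move=> p U [_ [[D DS <-] [X DX gpX] sU]].
have [F _ XE] := DS _ DX; rewrite -XE in DX gpX.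
apply: (@filterS _ (nbhs p) _ (\bigcap_(phi in [set` F])
    [set q : S_cbar | tp_set q (rename (act_rename g) phi)])).
  by move=> q qF; apply: sU; eexists; [exact: DX|exact: qF].
apply: filter_bigI => phi phiF; apply: open_nbhs_nbhs; split; last exact: gpX.
exact: open_tp.
Qed.

Lemma compl_continuous (g : aut C) :
  continuous (fun x : selfmap => (act g \o x : selfmap)).
Proof.
move=> x; apply: (ptws_cvgP (nbhs_filter x)) => p.
apply: (@continuous_comp _ _ _ (fun y : selfmap => y p) (act g)).
  exact: (@proj_continuous S_cbar (fun=> S_cbar) p x).
exact: act_continuous.
Qed.

Lemma act_mul (g h : aut C) : act (g * h)%g = act g \o act h.
Proof.
apply/funext => p; apply: tpspace_eq; have [a _ pE] := tp_setP p.
apply/funext => phi; rewrite /= /act_set /= pE /tp /=.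
apply/propext; rewrite !sat_rename.
suff -> : sum_val a c \o act_rename (g * h)%g =
  (sum_val a c \o act_rename h) \o act_rename g by [].
by apply/funext => -[].
Qed.

Lemma EL_act (g : aut C) x : EL x -> EL (act g \o x).
Proof.
move=> ELx U /compl_continuous/ELx[_ [[h _ <-] Uh]].
exists (act g \o act h); split=> //; exists (g * h)%g => //.
exact: act_mul.
Qed.

Lemma ELP x U : EL x -> nbhs x U -> exists g : aut C, U (act g).
Proof. by move=> ELx /ELx[_ [[g _ <-] Ug]]; exists g. Qed.

Lemma circP p A eta : circ p A eta <->
  EL eta /\ forall V U, nbhs p V -> nbhs eta U ->
    exists g x, [/\ A x, V (act g : selfmap) & U (act g \o x : selfmap)].
Proof.
split=> -[ELeta]; last first.
  move=> H; split=> //.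
  pose I := {VU : set selfmap * set selfmap | nbhs p VU.1 /\ nbhs eta VU.2}.
  have fP (i : I) : exists gx : aut C * selfmap,
      [/\ A gx.2, (projT1 i).1 (act gx.1 : selfmap)
        & (projT1 i).2 (act gx.1 \o gx.2 : selfmap)].
    case: i => -[V U] /= [pV etaU]; have [g [x [Ax Vg Ux]]] := H V U pV etaU.
    by exists (g, x).
  have [f fE] := choice fP.
  exists I, (fun i j => (projT1 j).1 `<=` (projT1 i).1 /\
                        (projT1 j).2 `<=` (projT1 i).2).
  exists (fun i => (f i).2), (fun i => (f i).1); split.
  - split.
    + by constructor; exists (setT, setT); split; exact: filterT.
    + by move=> i; split.
    + move=> i j k [ij1 ij2] [jk1 jk2].
      by split; [exact: subset_trans jk1 ij1|exact: subset_trans jk2 ij2].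
    + move=> [[V U] [pV etaU]] [[V' U'] [pV' etaU']].
      have VV : nbhs p (V `&` V') /\ nbhs eta (U `&` U').
        by split; exact: filterI.
      by exists (exist _ (V `&` V', U `&` U') VV) => /=; split; split => ? [].
  - by move=> i; have [] := fE i.
  - move=> V pV; have VT : nbhs p V /\ nbhs eta setT by split=> //; exact: filterT.
    exists (exist _ (V, setT) VT) => j [/= jV _].
    by apply: jV; have [] := fE j.
  - move=> U etaU; have TU : nbhs p setT /\ nbhs eta U by split=> //; exact: filterT.
    exists (exist _ (setT, U) TU) => j [/= _ jU].
    by apply: jU; have [] := fE j.
move=> [I [le [x [g [[_ _ _ ub] Ax gp geta]]]]]; split=> // V U pV etaU.
have [i iV] := gp V pV; have [j jU] := geta U etaU; have [k [ik jk]] := ub i j.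
by exists (g k), (x k); split=> //; [exact: iV|exact: jU].
Qed.

Section ellis_group.
Context (E : ellis_data).

Notation I := (ideal E).
Notation u := (idem E).

Definition uM : set selfmap := [set u \o m | m in I].

Record ellis_group := EllisGroup {
  eg_val :> selfmap;
  eg_in : uM eg_val }.

Lemma eg_eq (x y : ellis_group) : eg_val x = eg_val y -> x = y.
Proof.
by case: x y => [x xP] [y yP] /= xy; rewrite -{}xy in yP *; congr EllisGroup.
Qed.

Let IEL x : I x -> EL x.
Proof. by have [[IE _ _] _] := idealP E; exact: IE. Qed.

Let IM x y : EL x -> I y -> I (x \o y).
Proof. by have [[_ _ H] _] := idealP E; exact: H. Qed.

Let uI x : uM x -> I x.
Proof. by move=> [m Im <-]; apply: IM => //; exact/IEL/idem_in. Qed.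

Let Iprod x : I x -> [set y \o x | y in I] = I.
Proof.
have [_ Imin] := idealP E.
move=> Ix; apply: Imin => [|_ [y Iy <-]]; last exact: IM (IEL Iy) Ix.
split=> [_ [y Iy <-]||y _ ELy [z Iz <-]].
- by apply: IEL; exact: IM (IEL Iy) Ix.
- by exists (x \o x), x.
- by exists (y \o z); [exact: IM|].
Qed.

Let uMl x : uM x -> u \o x = x.
Proof. by move=> [m _ <-]; rewrite [LHS]compA idemP. Qed.

Let Ir x : I x -> x \o u = x.
Proof.
by rewrite -{1}(Iprod (idem_in E)) => -[y _ <-]; rewrite -[LHS]compA idemP.
Qed.

Let uM1 : uM u.
Proof. by exists u; [exact: idem_in|exact: idemP]. Qed.

Let uMM (x y : selfmap) : uM x -> uM y -> uM (x \o y).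
Proof.
move=> ux uy; exists (x \o y); first by apply: IM (IEL (uI ux)) (uI uy).
by rewrite compA uMl.
Qed.

Let uMV (x : ellis_group) : exists y : ellis_group, eg_val y \o eg_val x = u.
Proof.
have := idem_in E; rewrite -{1}(Iprod (uI (eg_in x))) => -[y Iy yx].
have uy : uM (u \o y) by exists y.
by exists (EllisGroup uy) => /=; rewrite -compA yx idemP.
Qed.

Definition eg1 : ellis_group := EllisGroup uM1.
Definition egM (x y : ellis_group) : ellis_group :=
  EllisGroup (uMM (eg_in x) (eg_in y)).
Definition egV (x : ellis_group) : ellis_group := projT1 (cid (uMV x)).

HB.instance Definition _ := gen_eqMixin ellis_group.
HB.instance Definition _ := gen_choiceMixin ellis_group.

Let egMA : associative egM. Proof. by move=> x y z; exact: eg_eq. Qed.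
Let eg1M : left_id eg1 egM.
Proof. by move=> x; apply: eg_eq; exact: uMl (eg_in x). Qed.
Let egM1 : right_id eg1 egM.
Proof. by move=> x; apply: eg_eq; exact: Ir (uI (eg_in x)). Qed.
Let egVM : left_inverse eg1 egV egM.
Proof. by move=> x; apply: eg_eq; rewrite /egV; case: cid. Qed.
Let egMV : right_inverse eg1 egV egM.
Proof.
move=> x; rewrite -[LHS]eg1M -{1}(egVM (egV x)) -egMA (egMA _ x) egVM eg1M.
exact: egVM.
Qed.

HB.instance Definition _ :=
  isGroup.Build ellis_group egMA eg1M egM1 egVM egMV.

Definition cl_tau (A : set selfmap) : set selfmap := circ u A `&` uM.

(* U is τ-open iff its complement F satisfies cl_τ(F) ⊆ F. *)
Definition tau_open : set_system ellis_group :=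
  [set U | forall x : ellis_group,
     cl_tau (eg_val @` (~` U)) x -> (~` U) x].

Let tau_openT : tau_open setT.
Proof.
move=> x [/circP[_ /(_ setT setT filterT filterT)]].
by move=> [g [y [[z []]]]].
Qed.

Let circS p A B : A `<=` B -> circ p A `<=` circ p B.
Proof.
move=> AB x /circP[ELx H]; apply/circP; split=> // V U pV xU.
by have [g [y [/AB]]] := H V U pV xU; exists g, y.
Qed.

Let circU p A B : circ p (A `|` B) `<=` circ p A `|` circ p B.
Proof.
move=> x /circP[ELx H]; apply: contrapT => /not_orP[].
move=> /circP/not_andP[//|/existsNP[V /existsNP[U]]].
move=> /not_implyP[pV /not_implyP[xU nA]].
move=> /circP/not_andP[//|/existsNP[V' /existsNP[U']]].
move=> /not_implyP[pV' /not_implyP[xU' nB]].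
have [] := H (V `&` V') (U `&` U'); [exact: filterI|exact: filterI|].
move=> g [y [[Ay|By] [Vg Vg'] [Uy Uy']]].
- by apply: nA; exists g, y.
- by apply: nB; exists g, y.
Qed.

Let tau_openI : setI_closed tau_open.
Proof.
move=> U V oU oV x [+ ux]; rewrite setCI image_setU => /circU[cU|cV].
- by left; apply: oU.
- by right; apply: oV.
Qed.

Let tau_open_bigU J (U : J -> set ellis_group) :
  (forall i, tau_open (U i)) -> tau_open (\bigcup_i U i).
Proof.
move=> oU x [cx ux] [i _ Ux]; apply: (oU i x _ Ux); split=> //.
apply: circS cx => _ [y nUy <-]; exists y => // Uiy; apply: nUy.
by exists i.
Qed.

HB.instance Definition _ :=
  isOpenTopological.Build ellis_group tau_openT tau_openI tau_open_bigU.

Section translations.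
Local Open Scope group_scope.

Lemma tau_openE (U : set ellis_group) : open U = tau_open U.
Proof. by []. Qed.

Lemma open_mulr (q : ellis_group) (U : set ellis_group) :
  open U -> open [set x | U (x * q)].
Proof.
rewrite !tau_openE => oU x [/circP[_ cx] ux] Uxq.
apply: (oU (x * q)) => //; split; last exact: eg_in.
apply/circP; split; first exact/IEL/uI/eg_in.
move=> V W uV /(@compr_continuous q (eg_val x) W) xW.
have [g [_ [[y nUy <-] Vg Wg]]] := cx _ _ uV xW.
by exists g, (eg_val (y * q)); split=> //; exists (y * q).
Qed.

Lemma open_mull (q : ellis_group) (U : set ellis_group) :
  open U -> open [set x | U (q * x)].
Proof.
rewrite !tau_openE => oU x [/circP[_ cx] ux] Uqx.
apply: (oU (q * x)) => //; split; last exact: eg_in.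
apply/circP; split; first exact/IEL/uI/eg_in.
move=> V W uV xW.
have qqV : eg_val q \o eg_val q^-1 = u by have := congr1 eg_val (mulgV q).
have uqV : u \o eg_val q^-1 = eg_val q^-1 by apply: uMl; exact: eg_in.
have qVq : eg_val q^-1 \o eg_val q = u by have := congr1 eg_val (mulVg q).
move: uV; rewrite -[X in nbhs X](_ : eg_val q \o eg_val q^-1 = u)//.
rewrite nbhsE => -[V' [oV' V'q V'V]]; move: xW; rewrite nbhsE => -[W' [oW' W'q W'W]].
have nV' : nbhs (eg_val q \o eg_val q^-1 : selfmap) V' by exact: open_nbhs_nbhs.
have nW' : nbhs (eg_val q \o eg_val x : selfmap) W' by exact: open_nbhs_nbhs.
have {}nV' : nbhs (eg_val q) [set z : selfmap | V' (z \o eg_val q^-1)].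
  exact: compr_continuous nV'.
have {}nW' : nbhs (eg_val q) [set z : selfmap | W' (z \o eg_val x)].
  exact: compr_continuous nW'.
have [k [kV kW]] := ELP (IEL (uI (eg_in q))) (filterI nV' nW').
have nbV z : V' z -> nbhs (z : selfmap) V' by move=> V'z; exact: open_nbhs_nbhs.
have nbW z : W' z -> nbhs (z : selfmap) W' by move=> W'z; exact: open_nbhs_nbhs.
have {}kV : nbhs (u : selfmap)
    [set z : selfmap | V' (act k \o (z \o eg_val q^-1))].
  have H : nbhs (u \o eg_val q^-1 : selfmap)
      [set z : selfmap | V' (act k \o z)].
    by rewrite uqV; exact: (compl_continuous (nbV _ kV)).
  exact: (compr_continuous H).
have {}kW : nbhs (eg_val x) [set z : selfmap | W' (act k \o z)].
  exact: (compl_continuous (nbW _ kW)).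
have [g [_ [[y nUy <-] Vg Wg]]] := cx _ _ kV kW.
have ELz : EL (act k \o (act g \o eg_val q^-1)).
  by apply/EL_act/EL_act/IEL/uI/eg_in.
have [h [Vh Wh]] : exists h : aut C,
    V' (act h) /\ W' (act h \o (eg_val q \o eg_val y)).
  apply: (ELP (U := [set z : selfmap |
    V' z /\ W' (z \o (eg_val q \o eg_val y))]) ELz).
  apply: filterI; first exact: nbV.
  have H : nbhs ((act k \o (act g \o eg_val q^-1)) \o (eg_val q \o eg_val y)
      : selfmap) W'.
    apply: nbW.
    suff -> : (act k \o (act g \o eg_val q^-1)) \o (eg_val q \o eg_val y) =
      act k \o (act g \o eg_val y) by [].
    rewrite -[LHS]compA; congr (_ \o _); rewrite -[LHS]compA; congr (_ \o _).
    by rewrite compA qVq uMl//; exact: eg_in.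
  exact: (compr_continuous H).
exists h, (eg_val (q * y)); split; [by exists (q * y)|exact: V'V|exact: W'W].
Qed.

End translations.

Definition H_uM_set : set ellis_group :=
  \bigcap_(V in nbhs (1%g : ellis_group)) closure V.

Section H_uM_normal.
Local Open Scope group_scope.

Lemma H_uM_setP x : H_uM_set x <-> forall V U : set ellis_group,
  open V -> open U -> V 1 -> U x -> V `&` U !=set0.
Proof.
split=> [Hx V U oV oU V1 Ux|H V].
  by apply: Hx; exact: open_nbhs_nbhs.
rewrite nbhsE => -[V' [oV' V'1] V'V] U; rewrite nbhsE => -[U' [oU' U'x] U'U].
have [y [V'y U'y]] := H _ _ oV' oU' V'1 U'x.
by exists y; split; [exact: V'V|exact: U'U].
Qed.

Lemma H_uM_normal : normal H_uM_set.
Proof.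
split; first split.
- by apply/H_uM_setP => V U _ _ V1 U1; exists 1.
- move=> x y /H_uM_setP Hx /H_uM_setP Hy; apply/H_uM_setP => V U oV oU V1 Uxy.
  have [z [Vz Uxz]] := Hy _ _ oV (@open_mull x _ oU) V1 Uxy.
  have [|//|t [/= Vt Ut]] := Hx _ _ (@open_mulr z _ oV) (@open_mulr z _ oU).
    by rewrite /= mul1g.
  by exists (t * z).
- move=> x /H_uM_setP Hx; apply/H_uM_setP => V U oV oU V1 UxV.
  have [|/=|t [/= Ut Vt]] := Hx _ _ (@open_mull x^-1 _ oU) (@open_mull x^-1 _ oV).
  + by rewrite /= mulg1.
  + by rewrite mulVg.
  by exists (x^-1 * t).
- move=> g x /H_uM_setP Hx; apply/H_uM_setP => V U oV oU V1 Ux.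
  have [|/=|t [/= Vt Ut]] := Hx _ _
    (@open_mull g _ (@open_mulr g^-1 _ oV)) (@open_mull g _ (@open_mulr g^-1 _ oU)).
  + by rewrite /= mulg1 mulgV.
  + exact: Ux.
  by exists (g * t * g^-1).
Qed.

End H_uM_normal.

Definition H_uM : normal_subgroup ellis_group := NormalSubgroup H_uM_normal.

(* Its topology is the quotient of the τ-topology, see [quot_open]. *)
Definition ellis_quotient : Type := quot H_uM.

HB.instance Definition _ := TGroup.on ellis_quotient.
HB.instance Definition _ := Quotient.on ellis_quotient.

End ellis_group.

Record small_model := SmallModel {
  sm :> structure L;
  sm_emb : elem_embedding sm C';
  sm_small : card_lt sm (degC' P) }.

Definition autf_gen : set (aut C') :=
  [set s | exists m : small_model, forall x : m, s (sm_emb m x) = sm_emb m x].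

Definition autfL_set : set (aut C') := smallest subgroup autf_gen.

Lemma autfL_normal : normal autfL_set.
Proof.
split; first split.
- by move=> N [[N1 _ _] _].
- move=> x y Hx Hy N NP; have [[_ NM _] _] := NP.
  by apply: NM; [exact: Hx|exact: Hy].
- by move=> x Hx N NP; have [[_ _ NV] _] := NP; apply: NV; exact: Hx.
move=> g x Hx N [[N1 NM NV] genN].
apply: (Hx [set y | N (g * y * g^-1)%g]); split.
  split=> [|y z Ny Nz|y Ny] /=; first by rewrite mulg1 mulgV.
  - have := NM _ _ Ny Nz; congr (N _).
    by rewrite !mulgA mulgVK.
  - by have := NV _ Ny; rewrite !invgM invgK mulgA.
move=> s [m sE]; apply: genN.
have emb : same_type (@id (sm m)) (g \o sm_emb m).
  by move=> phi; rewrite -aut_sat; exact: embP.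
exists (SmallModel (ElemEmbedding emb) (sm_small m)) => y /=.
by congr (g _); rewrite aut_funK sE.
Qed.

Definition autfL : normal_subgroup (aut C') := NormalSubgroup autfL_normal.

Definition galL : Type := quot autfL.

HB.instance Definition _ := Group.on galL.
HB.instance Definition _ := Quotient.on galL.

(* The class of a chosen s with tp(s(m) / m) = p. *)
Definition gal_of_type (m : small_model) (p : tpspace (sm_emb m)) : galL :=
  \pi_galL (xget 1%g [set s : aut C' | tp (s \o sm_emb m) (sm_emb m) = p]).

(* [galL] with the quotient topology given by [gal_of_type m]; this topology
   does not depend on [m]. *)
Definition galL_top (m : small_model) : Type := galL.

Section galL_topology.
Context (m : small_model).

HB.instance Definition _ := Group.on (galL_top m).

Definition galL_open : set_system (galL_top m) :=
  [set U | open (@gal_of_type m @^-1` U)].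

Let galL_openT : galL_open setT.
Proof. exact: openT. Qed.
Let galL_openI : setI_closed galL_open.
Proof. by move=> U V; exact: openI. Qed.
Let galL_open_bigU J (U : J -> set (galL_top m)) :
  (forall i, galL_open (U i)) -> galL_open (\bigcup_i U i).
Proof.
move=> oU; rewrite /galL_open /= preimage_bigcup.
by apply: bigcup_open => i _; exact: oU.
Qed.

HB.instance Definition _ := isOpenTopological.Build (galL_top m)
  galL_openT galL_openI galL_open_bigU.

Definition gal0 : set galL := closure [set (1%g : galL_top m)].

End galL_topology.

Definition pi0 (x : selfmap) : S_cbar := x (tp_refl c).

(* The class of a chosen s with s(cbar) realizing [pi0 x]. *)
Definition fhat (x : selfmap) : galL :=
  \pi_galL (xget 1%g [set s : aut C' | tp (s \o c) c = pi0 x]).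

Definition f_uM (E : ellis_data) (x : ellis_group E) : galL := fhat x.

Definition fbar (E : ellis_data) (x : ellis_quotient E) : galL := f_uM (repr x).

End ellis.

(* Main.v *)
(** Everything is done with ultrafilters.  An ultrafilter limit of types of small
    tuples is realized in [C'], so the limits of [g_i] and of [g_i x_i] in the
    Ellis semigroup are realized by a pair of tuples whose joint type is the
    limit of the relative positions given by the [x_i].  From this come the
    multiplicativity of [fhat], the triviality of [f] on [H(uM)] and the
    continuity of [f].

    In the τ-topology, if [x_i] tends to [x] and [x_i y_i] to [z] in the Ellis
    semigroup, with [y_i] in [uM], then [y_i] tends to [(ux)^-1 uz].  Hence every
    ultrafilter on [uM * uM] has limits compatible with the product, which makes
    [uM/H(uM)] compact and Hausdorff with jointly continuous multiplication,
    without Ellis' joint continuity theorem.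

    Moreover [f] is a quotient map.  If [x_i] tends to [x], the classes of the
    [x_i] lie in [B] and the preimage of [B] under [f] is τ-closed, write
    [x_i u = v_i s_i] with [v_i] idempotent in the ideal and [s_i = u x_i u].  An
    idempotent moves [cbar] to a tuple of the same type over a conjugate of
    [cbar]; this passes to the limit [v] of the [v_i], so [fhat v = 1] and the
    class of [x] is that of a τ-limit of the [s_i], hence lies in [B].  As [clY]
    is saturated for [fbar], its image is closed; by continuity, it is contained
    in the closure of the identity. *)

Require Import Defs.
From mathcomp Require Import all_boot all_classical.
From mathcomp Require Import finmap topology.

Set Implicit Arguments.
Unset Strict Implicit.
Unset Printing Implicit Defensive.

Local Open Scope classical_set_scope.
Local Open Scope card_scope.
Local Open Scope quotient_scope.

(** * Cardinals *)

Lemma card_leTP (A B : Type) :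
  [set: A] #<= [set: B] <-> exists f : A -> B, injective f.
Proof.
split=> [/card_leP[f]|[f fI]].
  pose i (x : A) : [set: A] := SigSub (mem_set (I : [set: A] x)).
  exists (fun x => val (f (i x))) => x y /val_inj.
  by move=> /(@inj _ _ _ f)-/(_ (mem_set I) (mem_set I)) [].
have [g] : $|{injfun [set: A] >-> [set: B]}|.
  by apply/injfunPex; exists f => // x y _ _; exact: fI.
exact: inj_card_le g.
Qed.

(** A maximal partial injection, given by Zorn's lemma, covers one of the two types: otherwise a
    pair of uncovered points could be added to it. *)
Lemma card_le_total (A B : Type) :
  [set: A] #<= [set: B] \/ [set: B] #<= [set: A].
Proof.
pose inj2 (R : set (A * B)) := forall z t, R z -> R t ->
  (z.1 = t.1 <-> z.2 = t.2).
have [|R [Ri Rmax]] := @Zorn_bigcup _ inj2.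
- move=> F FP Ftot z t [X FX Xz] [Y FY Yt].
  have [/(_ _ Xz) Yz|/(_ _ Yt) Xt] := Ftot _ _ FX FY.
    exact: (FP _ FY).
  exact: (FP _ FX).
have [H|/existsNP[a0 Ha0]] := pselect (forall a, exists b, R (a, b)).
  have [f fE] := choice H; left; apply/card_leTP; exists f => x y fxy.
  exact: (Ri _ _ (fE x) (fE y)).2.
have [H|/existsNP[b0 Hb0]] := pselect (forall b, exists a, R (a, b)).
  have [f fE] := choice H; right; apply/card_leTP; exists f => x y fxy.
  exact: (Ri _ _ (fE x) (fE y)).1.
exfalso; apply: (Rmax (R `|` [set (a0, b0)])).
  split=> [z Rz|]; first by left.
  by move=> /(_ (a0, b0) (or_intror erefl)) Rab; apply: Ha0; exists b0.
move=> [a b] [a' b'] [Rz|[-> ->]] [Rt|[-> ->]] //=.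
- exact: (Ri _ _ Rz Rt).
- by split=> E; [case: Ha0; exists b; rewrite -E|case: Hb0; exists a; rewrite -E].
- by split=> E; [case: Ha0; exists b'; rewrite E|case: Hb0; exists a'; rewrite E].
Qed.

Lemma card_lt_le (X Y K : Type) (f : X -> Y) :
  injective f -> card_lt Y K -> card_lt X K.
Proof.
move=> fI [YK KY]; have XY : [set: X] #<= [set: Y] by apply/card_leTP; exists f.
by split; [exact: card_le_trans XY YK|move=> /card_le_trans/(_ XY)].
Qed.

(** [strong_limit] is stated for subsets of [K], so [X] is first replaced by its image under an
    injection into [K]. *)
Lemma card_lt_pow (X K : Type) : strong_limit K -> card_lt X K -> card_lt (set X) K.
Proof.
move=> [_ Kpow] [/card_leTP[f fI] KX].
pose R := range f.
have fR x : f x \in R by apply/mem_set; exists x.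
pose g x : R := SigSub (fR x).
have gI : injective g by move=> x y /(congr1 val)/fI.
have hP (r : R) : exists x, f x = val r.
  by have [x _ xr] := set_valP r; exists x.
have [h hE] := choice hP.
have hI : injective h by move=> r s rs; apply/val_inj; rewrite -!hE rs.
have RK : card_lt R K.
  apply: (card_lt_le hI); split=> //; apply/card_leTP; by exists f.
apply: (@card_lt_le _ _ _ (fun S : set X => g @` S) _ (Kpow _ RK)).
move=> S T ST; apply/seteqP; split=> x Sx.
  have : [set g x | x in S] (g x) by exists x.
  by rewrite ST => -[y Ty /gI<-].
have : [set g x | x in T] (g x) by exists x.
by rewrite -ST => -[y Ty /gI<-].
Qed.

(** The sum injects into the double power set of the larger summand, and two power sets stay below a
    strong limit. *)
Lemma card_lt_sum (X Y K : Type) :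
  strong_limit K -> card_lt X K -> card_lt Y K -> card_lt (X + Y) K.
Proof.
move=> KL.
wlog XY : X Y / [set: X] #<= [set: Y].
  move=> W KX KY; have [XY|YX] := card_le_total X Y; first exact: W.
  apply: (@card_lt_le _ (Y + X) _
    (fun z => match z with inl x => inr x | inr y => inl y end)).
    by move=> [x|x] [y|y] // [->].
  exact: W.
move: XY => /card_leTP[f fI] _ YK.
(* The empty set, as an additional member, marks the elements that come from [X]. *)
pose g (z : X + Y) : set (set Y) :=
  match z with inl x => [set [set f x]; set0] | inr y => [set [set y]] end.
apply: (@card_lt_le _ _ _ g); last by do 2! apply: card_lt_pow => //.
have s0 y : ([set y] : set Y) <> set0 by move=> /seteqP[/(_ y erefl)].
have s1 (y y' : Y) : [set y] = [set y'] -> y = y' by move=> /seteqP[/(_ y erefl)].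
move=> [x|y] [x'|y'] /= E.
- have := or_introl erefl : [set [set f x]; set0] [set f x].
  by rewrite E => -[/s1/fI->|/s0].
- have := or_intror erefl : [set [set f x]; set0] set0.
  by rewrite E => /esym/s0.
- have := or_intror erefl : [set [set f x']; set0] set0.
  by rewrite -E => /esym/s0.
- by have := erefl : [set [set y]] [set y]; rewrite E => /s1->.
Qed.

Lemma card_lt_fin (n : nat) (K : Type) : strong_limit K -> card_lt 'I_n K.
Proof.
move=> [Kinf _].
have KI : ~ ([set: K] #<= [set: 'I_n]).
  by move=> /(card_le_finite) H; apply: Kinf; apply: H; exact: finite_finset.
have [|//] := card_le_total 'I_n K.
by split.
Qed.

(** * Realizing ultraproduct limits of types *)

Section formulas.
Context {L : language}.

Lemma trename_comp X Y Z (h : X -> Y) (k : Y -> Z) (t : term L X) :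
  trename k (trename h t) = trename (k \o h) t.
Proof. by elim: t => //= f ts IH; congr App; apply/funext. Qed.

Lemma rename_comp X (phi : formula L X) : forall Y Z (h : X -> Y) (k : Y -> Z),
  rename k (rename h phi) = rename (k \o h) phi.
Proof.
elim: phi => {X} //= [X t1 t2|X r ts|X p IHp q IHq|X p IH] Y Z h k.
- by rewrite !trename_comp.
- by congr Rel; apply/funext => i; rewrite trename_comp.
- by rewrite IHp IHq.
- by rewrite IH; congr (All (rename _ _)); apply/funext => -[].
Qed.

Lemma term_support X (t : term L X) :
  exists (J : finType) (h : J -> X) (t' : term L J), t = trename h t'.
Proof.
elim: t => [x|f ts IH]; first by exists unit, (fun=> x), (Var L tt).
have H i : exists s : {J : finType & ((J -> X) * term L J)%type},
    ts i = trename (projT2 s).1 (projT2 s).2.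
  by have [J [h [t' E]]] := IH i; exists (existT _ J (h, t')).
have [s sE] := choice H.
exists {i : 'I_(fn_arity f) & projT1 (s i)},
  (fun z => (projT2 (s (projT1 z))).1 (projT2 z)),
  (App (fun i => trename (fun j => existT _ i j) (projT2 (s i)).2)).
by rewrite /=; congr App; apply/funext => i; rewrite trename_comp sE.
Qed.

(** Finite supports allow types to be handled piecewise, in unions of chains and in the density of
    the orbit. *)
Lemma formula_support X (phi : formula L X) :
  exists (J : finType) (h : J -> X) (psi : formula L J), phi = rename h psi.
Proof.
elim: phi => {X} [X t1 t2|X r ts|X|X p IHp q IHq|X p IH].
- have [J1 [h1 [t1' ->]]] := term_support t1.
  have [J2 [h2 [t2' ->]]] := term_support t2.
  exists (J1 + J2)%type, (fun z => match z with inl x => h1 x | inr x => h2 x end).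
  by exists (Eqn (trename inl t1') (trename inr t2')); rewrite /= !trename_comp.
- have H i : exists s : {J : finType & ((J -> X) * term L J)%type},
      ts i = trename (projT2 s).1 (projT2 s).2.
    have [J [h [t' E]]] := term_support (ts i).
    by exists (existT _ J (h, t')).
  have [s sE] := choice H.
  exists {i : 'I_(rl_arity r) & projT1 (s i)},
    (fun z => (projT2 (s (projT1 z))).1 (projT2 z)),
    (Rel (fun i => trename (fun j => existT _ i j) (projT2 (s i)).2)).
  by rewrite /=; congr Rel; apply/funext => i; rewrite trename_comp sE.
- by exists void, (of_void X), Bot.
- have [J1 [h1 [p' ->]]] := IHp; have [J2 [h2 [q' ->]]] := IHq.
  exists (J1 + J2)%type, (fun z => match z with inl x => h1 x | inr x => h2 x end).
  by exists (Imp (rename inl p') (rename inr q')); rewrite /= !rename_comp.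
- have [J [h [p' ->]]] := IH.
  (* The variables of the body sent to [None] are bound by the quantifier and drop out of the
     support; [insub] sends them back to [None]. *)
  have hP (j : {j : J | h j}) : exists x, h (val j) = Some x.
    by case: j => j /=; case: (h j) => // x _; exists x.
  have [h' h'E] := choice hP.
  exists {j : J | h j}, h', (All (rename insub p')) => /=.
  rewrite rename_comp; congr (All (rename _ _)); apply/funext => j /=.
  case: insubP => [j' _ <- /=|]; first exact: h'E.
  by case: (h j).
Qed.

Definition And X (p q : formula L X) : formula L X := Imp (Imp p (Imp q Bot)) Bot.
Definition Ex X (p : formula L (option X)) : formula L X :=
  Imp (All (Imp p Bot)) Bot.

Lemma sat_And (M : structure L) X (v : X -> M) p q :
  sat v (And p q) <-> sat v p /\ sat v q.
Proof.
split=> [/= H|[/= Hp Hq] H]; last exact: H.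
by split; apply: contrapT => n; apply: H => a b; apply: n.
Qed.

Lemma sat_Ex (M : structure L) X (v : X -> M) p :
  sat v (Ex p) <-> exists a, sat (oapp v a) p.
Proof.
split=> [/= H|[a pa] /= H]; last exact: (H a).
by apply: contrapT => n; apply: H => a pa; apply: n; exists a.
Qed.

Lemma finite_conj X (F : set (formula L X)) : finite_set F ->
  exists chi : formula L X, forall (M : structure L) (v : X -> M),
    sat v chi <-> forall phi, F phi -> sat v phi.
Proof.
move=> /finite_seqP[s ->]; elim: s => [|p s [chi IH]].
  by exists (Imp Bot Bot) => M v; split=> // _ phi.
exists (And p chi) => M v; rewrite sat_And IH; split=> [[pv sv] phi|H].
  by rewrite /= inE => /orP[/eqP->//|]; exact: sv.
by split=> [|phi sphi]; apply: H; rewrite /= inE ?eqxx//; apply/orP; right.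
Qed.

(** Saturation and homogeneity are stated for subsets of a model. A tuple, possibly with
    repetitions, is traded for its range by choosing an index of each element. *)
Lemma range_small (K X : Type) (M : structure L) (e : X -> M) :
  card_lt X K -> exists s : range e -> X,
    cancel s (fun x => SigSub (mem_set (imageT e x))) /\ card_lt (range e) K.
Proof.
move=> XK; have hP (r : range e) : exists x, e x = val r.
  by have [x _ xr] := set_valP r; exists x.
have [s sE] := choice hP.
have sK : cancel s (fun x => SigSub (mem_set (imageT e x))).
  by move=> r; apply/val_inj; exact: sE.
by exists s; split=> //; apply: card_lt_le (can_inj sK) XK.
Qed.

Lemma saturated_tuple (K X : Type) (M : structure L) (e : X -> M)
    (p : set (formula L (unit + X))) : saturated K M -> card_lt X K ->
  (forall F, finite_set F -> F `<=` p ->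
     exists x : M, forall phi, F phi -> sat (sum_val (fun=> x) e) phi) ->
  exists x : M, forall phi, p phi -> sat (sum_val (fun=> x) e) phi.
Proof.
move=> Msat XK pfin; have [s [sK RK]] := range_small e XK.
pose r (z : unit + X) : unit + range e :=
  match z with inl x => inl x | inr x => inr (SigSub (mem_set (imageT e x))) end.
have rE (x : M) : sum_val (fun=> x) set_val \o r = sum_val (fun=> x) e.
  by apply/funext => -[].
have [F Ffin Fp|x xp] := Msat (range e) [set rename r phi | phi in p] RK; last first.
  exists x => phi pphi; rewrite -rE; apply/sat_rename; apply: xp.
  by exists phi.
(* Formulas of [F] are lifted to [p]; [Bot] is a dummy value outside [F]. *)
have Hg (psi : formula L (unit + range e)) : exists phi,
    F psi -> p phi /\ rename r phi = psi.
  have [/Fp[phi pphi <-]|nF] := pselect (F psi); first by exists phi.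
  by exists Bot.
have [g gE] := choice Hg.
have [|_ [psi Fpsi <-]|x xF] := pfin [set g psi | psi in F].
- exact: finite_image.
- by have [] := gE _ Fpsi.
exists x => psi Fpsi; have [_ <-] := gE _ Fpsi.
by rewrite sat_rename rE; apply: xF; exists psi.
Qed.

Lemma homogeneous_tuple (K X : Type) (M : structure L) (a b : X -> M) :
  strongly_homogeneous K M -> card_lt X K -> same_type a b ->
  exists g : aut M, g \o a = b.
Proof.
move=> Mhom XK ab; have [s [sK RK]] := range_small a XK.
have E x : a (s (SigSub (mem_set (imageT a x)))) = a x.
  by have /(congr1 val) := sK (SigSub (mem_set (imageT a x))).
(* Equalities between entries of [a] belong to its type, so [b] is constant on the fibres of [a]. *)
have bE x : b (s (SigSub (mem_set (imageT a x)))) = b x.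
  exact: (ab (Eqn (Var L _) (Var L _))).1 (E x).
have [|g gE] := Mhom (range a) (b \o s) RK.
  have vE : set_val = a \o s :> (range a -> M).
    by apply/funext => z; have /(congr1 val) := sK z.
  move=> phi; rewrite vE -sat_rename -[X in _ <-> X]sat_rename; exact: ab.
exists g; apply/funext => x /=.
by have /= -> := gE (SigSub (mem_set (imageT a x))).
Qed.

End formulas.

(** * Ultrafilters and partial elementary maps on ultraproducts *)

Section ultrafilters.
Context {I : Type} (F : set_system I) {FU : UltraFilter F}.

Lemma ultra_const (P : Prop) : F [set _ | P] <-> P.
Proof.
split=> [/filter_ex[]//|p]; have -> : [set _ : I | P] = setT.
  by apply/seteqP; split.
exact: filterT.
Qed.

Lemma ultra_fmap (J : Type) (f : I -> J) : UltraFilter (f @ F).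
Proof.
split=> [|G GP FG]; first exact: fmap_proper_filter.
apply/seteqP; split=> [A GA|]; last exact: FG.
have [//|FnA] := in_ultra_setVsetC (f @^-1` A) FU.
have GnA : G (~` A) by apply: FG.
by have /filter_ex[x []] : G (A `&` ~` A) by exact: filterI.
Qed.

Lemma filter_finite_forall (T : eqType) (S : set T) (A : T -> set I) :
  finite_set S -> (forall t, S t -> F (A t)) -> F [set i | forall t, S t -> A t i].
Proof.
move=> /finite_seqP[s ->]; elim: s => [_|t s IH H].
  by apply: filterS filterT => i _ t.
have Ft : F (A t) by apply: H; rewrite /= mem_head.
have Fs : F [set i | forall u, [set` s] u -> A u i].
  by apply: IH => u us; apply: H; rewrite /= inE; apply/orP; right.
apply: filterS (filterI Ft Fs) => i [At As] u.
by rewrite /= inE => /orP[/eqP->//|/As].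
Qed.

End ultrafilters.

Section realize.
Context {L : language} {I : Type} (F : set_system I) {FU : UltraFilter F}.
Context {X : Type} {N : I -> structure L} (d : forall i, X -> N i).
Context {M : structure L}.

(** By Łoś's theorem, this means that sending the class of [d i x] in the ultraproduct of the [N i]
    to [a], for [(x, a)] in [R], is a partial elementary map. *)
Definition ultra_elementary (R : set (X * M)) :=
  forall (J : finType) (h : J -> X * M), (forall k, R (h k)) ->
  forall psi : formula L J,
    sat (snd \o h) psi <-> F [set i | sat (d i \o (fst \o h)) psi].

Lemma ultra_elementary_any R Y (h : Y -> X * M) (phi : formula L Y) :
  ultra_elementary R -> (forall k, R (h k)) ->
  sat (snd \o h) phi <-> F [set i | sat (d i \o (fst \o h)) phi].
Proof.
move=> Rel Rh; have [J [k [psi ->]]] := formula_support phi.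
rewrite sat_rename (Rel J (h \o k)) => [|x]; last exact: Rh.
by under [X in _ <-> F X]eq_set do rewrite (propext (sat_rename _ _ _)).
Qed.

Lemma ultra_elementary_inj R z t : ultra_elementary R -> R z -> R t ->
  z.1 = t.1 -> z.2 = t.2.
Proof.
move=> Rel Rz Rt zt; pose h (b : bool) := if b then z else t.
have Rh b : R (h b) by case: b.
apply: (Rel _ h Rh (Eqn (Var L true) (Var L false))).2 => /=.
by rewrite zt; apply: filterS filterT.
Qed.

(** The type required of the new value is finitely satisfiable: the existential closure of a finite
    part holds on a set of [F], with witness [d i x0], hence holds in [M]. Saturation then realizes
    the whole type. *)
Lemma ultra_elementary_extend (K : Type) R x0 :
  saturated K M -> card_lt X K -> ultra_elementary R ->
  exists a, ultra_elementary (R `|` [set (x0, a)]).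
Proof.
move=> Msat XK Rel; pose Y : Type := set_type R.
(* The first projection is injective on [R], so [R] is no larger than [X]. *)
have YK : card_lt Y K.
  apply: (card_lt_le (f := fst \o set_val) _ XK) => z t zt.
  have zt2 := ultra_elementary_inj Rel (set_valP z) (set_valP t) zt.
  have pE (u v : X * M) : u.1 = v.1 -> u.2 = v.2 -> u = v.
    by case: u v => [? ?] [? ?] /= -> ->.
  by apply/val_inj/pE.
pose b i : unit + Y -> N i := sum_val (fun=> d i x0) (d i \o (fst \o set_val)).
pose e : Y -> M := snd \o set_val.
pose p := [set phi : formula L (unit + Y) | F [set i | sat (b i) phi]].
have [|a aP] := @saturated_tuple _ K Y M e p Msat YK.
  move=> G Gfin Gp.
  have [chi chiE] := finite_conj Gfin.
  pose r (z : unit + Y) : option Y := match z with inl _ => None | inr y => Some y end.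
  have rE (N' : structure L) (v : Y -> N') x :
      oapp v x \o r = sum_val (fun=> x) v by apply/funext => -[].
  suff /sat_Ex[x] : sat e (Ex (rename r chi)).
    by rewrite sat_rename rE => /chiE xG; exists x.
  apply/(ultra_elementary_any _ Rel (fun z : Y => set_valP z)).
  have FG : F [set i | forall phi, G phi -> sat (b i) phi].
    by apply: filter_finite_forall => // phi /Gp.
  apply: filterS FG => i iG; apply/sat_Ex; exists (d i x0).
  by rewrite sat_rename rE; apply/chiE.
(* As [F] is an ultrafilter, [p] contains each formula or its negation. *)
have {}aP phi : sat (sum_val (fun=> a) e) phi <-> F [set i | sat (b i) phi].
  split=> [aphi|]; last exact: aP.
  have [//|/(aP (Imp phi Bot))/(_ aphi)//] := in_ultra_setVsetC [set i | sat (b i) phi] FU.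
exists a => J h Rh psi.
have kP x : exists z : unit + Y,
    h x = match z with inl _ => (x0, a) | inr y => set_val y end.
  case: (Rh x) => [Rhx|->]; last by exists (inl tt).
  by exists (inr (SigSub (mem_set Rhx))).
have [k kE] := choice kP.
have -> : snd \o h = sum_val (fun=> a) e \o k.
  by apply/funext => x /=; rewrite kE; case: (k x).
rewrite -sat_rename aP; suff E i : b i \o k = d i \o (fst \o h).
  by under eq_set do rewrite (propext (sat_rename _ _ _)) E.
by apply/funext => x /=; rewrite kE; case: (k x).
Qed.

End realize.

(* [j] and [e] prescribe the realization on a part of the variables. *)
Lemma realize_ultra (L : language) (I X B K : Type) (F : set_system I)
    (N : I -> structure L) (d : forall i, X -> N i) (M : structure L)
    (j : B -> X) (e : B -> M) :
  UltraFilter F -> saturated K M -> card_lt X K ->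
  (forall psi : formula L B, sat e psi <-> F [set i | sat (d i \o j) psi]) ->
  exists a : X -> M, (forall phi, sat a phi <-> F [set i | sat (d i) phi]) /\
    a \o j = e.
Proof.
move=> FU Msat XK eP.
pose R0 : set (X * M) := [set (j b, e b) | b in setT].
(* Zorn's lemma on the partial elementary maps that extend [R0]; by one-point extension, a maximal
   one is total. *)
have [|A [Agood Amax]] :=
    @Zorn_bigcup _ [set R | ultra_elementary F d (R `|` R0)].
  move=> C Cgood Ctot J h hC psi.
  (* A finite tuple lies in one member of the chain together with [R0]; [set0] serves when [R0]
     alone contains it. *)
  have [Z ZC hZ] : exists2 Z, C Z \/ Z = set0 & forall x, (Z `|` R0) (h x).
    suff [Z ZC hZ] : exists2 Z, C Z \/ Z = set0 &
        forall x, x \in enum J -> (Z `|` R0) (h x).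
      by exists Z => // x; apply: hZ; rewrite mem_enum.
    elim: (enum J) => [|x s [Z ZC IH]]; first by exists set0; [right|].
    case: (hC x) => [[W CW Whx]|R0x]; last first.
      by exists Z => // y; rewrite inE => /orP[/eqP->|/IH//]; right.
    have [WZ|ZW] : W `<=` Z \/ Z `<=` W.
      by case: ZC => [CZ|->]; [exact: Ctot|right].
      exists Z => // y; rewrite inE => /orP[/eqP->|/IH//]; left; exact: WZ.
    exists W => [|y]; first by left.
    rewrite inE => /orP[/eqP->|/IH[/ZW|]]; [by left|by left|by right].
  have Zgood : ultra_elementary F d (Z `|` R0).
    case: ZC => [/Cgood//|->]; rewrite set0U => {}J {}h {hC hZ}hR {}psi.
    have bP x : exists b, h x = (j b, e b).
      by have [b _ <-] := hR x; exists b.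
    have [b bE] := choice bP.
    have -> : snd \o h = e \o b by apply/funext => x /=; rewrite bE.
    have E : fst \o h = j \o b by apply/funext => x /=; rewrite bE.
    rewrite -sat_rename eP E.
    by under eq_set do rewrite (propext (sat_rename _ _ _)).
  exact: Zgood hZ psi.
have aP x : exists a, (A `|` R0) (x, a).
  apply: contrapT => nx.
  have [a aP] := ultra_elementary_extend x Msat XK Agood.
  apply: (Amax (A `|` [set (x, a)])); last first.
    by move: aP => /=; rewrite setUAC.
  split=> [z|AA]; first by left.
  by apply: nx; exists a; left; apply: AA; right.
have [a aE] := choice aP.
exists a; split=> [phi|].
  exact: (ultra_elementary_any (h := fun x => (x, a x)) phi Agood aE).
apply/funext => b /=.
have Rb : (A `|` R0) (j b, e b) by right; exists b.
exact: (ultra_elementary_inj Agood (aE (j b)) Rb).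
Qed.

(** * Types and Galois groups *)

(** A downward directed family of nonempty sets is a base of a proper filter. In this way families
    of approximations, such as those given by [circ], become ultrafilters. *)
Lemma ultra_base (I D : Type) (B : set D) (A : D -> set I) : B !=set0 ->
  (forall d d', B d -> B d' -> exists2 d'', B d'' & A d'' `<=` A d `&` A d') ->
  (forall d, B d -> A d !=set0) ->
  exists F, UltraFilter F /\ forall d, B d -> F (A d).
Proof.
move=> B0 BI A0.
have FF : ProperFilter (filter_from B A).
  apply: filter_from_proper => //; apply: filter_from_filter => //.
have [F [FU FF']] := ultraFilterLemma FF.
by exists F; split=> // d Bd; apply: FF'; exists d.
Qed.

Lemma closure_ultra (I : Type) (T : topologicalType) (f : I -> T) (S : set I) x :
  closure (f @` S) x -> exists F, [/\ UltraFilter F, F S & f @ F --> x].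
Proof.
move=> clx.
have [| | |F [FU FB]] := @ultra_base I (set T) (nbhs x) (fun U => S `&` f @^-1` U).
- by exists setT; exact: filterT.
- move=> U V xU xV; exists (U `&` V); first exact: filterI.
  by move=> i [Si [Ui Vi]]; split.
- by move=> U /clx[_ [[i Si <-] Ui]]; exists i.
exists F; split=> //.
  have FS := FB _ (@filterT _ _ (nbhs_filter x)).
  by apply: filterS FS => i [].
move=> U /FB FxU; have FfU : F (f @^-1` U) by apply: filterS FxU => i [].
exact: FfU.
Qed.

Lemma closed_cvg_ultra (I : Type) (T : topologicalType) (F : set_system I)
    (f : I -> T) (A : set T) x :
  ProperFilter F -> closed A -> F (f @^-1` A) -> f @ F --> x -> A x.
Proof.
move=> FF Acl FA fx; apply: Acl => U /fx FfU.
have /filter_ex[i [Ai Ui]] : F (f @^-1` A `&` f @^-1` U) by exact: filterI.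
by exists (f i).
Qed.

Lemma ultra_cvg_open (I : Type) (T : topologicalType) (F : set_system I)
    (f : I -> T) x : UltraFilter F ->
  (forall U, open U -> U x -> ~ F (f @^-1` (~` U))) -> f @ F --> x.
Proof.
move=> FU H U; rewrite nbhsE => -[V [oV Vx] VU].
apply: (filterS (P := f @^-1` V)); first by move=> i; exact: VU.
have [//|FnV] := in_ultra_setVsetC (f @^-1` V) FU.
by have := H V oV Vx.
Qed.

Section types.
Context {L : language}.

Lemma sum_val_inl (N : Type) X A (a : X -> N) (b : A -> N) : sum_val a b \o inl = a.
Proof. exact/funext. Qed.

Context {N : structure L} {A : Type} {e : A -> N}.

Lemma tpE (p : tpspace e) phi :
  tp_set p (Imp phi Bot) <-> ~ tp_set p phi.
Proof. by have [a _ ->] := tp_setP p. Qed.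

Context {I : Type} {F : set_system I} {FU : UltraFilter F}.

Lemma tp_cvg (f : I -> tpspace e) (p : tpspace e) :
  (forall phi, tp_set p phi -> F [set i | tp_set (f i) phi]) -> f @ F --> p.
Proof.
move=> H U [_ [[D DS <-] [X DX pX] sU]].
have [G _ XE] := DS _ DX; rewrite -XE in DX pX.
apply: (@filterS _ F _ (\bigcap_(phi in [set` G]) [set i | tp_set (f i) phi])).
  by move=> i iG; apply: (sU (f i)); eexists; [exact: DX|exact: iG].
by apply: filter_bigI => phi phiG; apply: H; exact: pX.
Qed.

(** The sets given by formulas are clopen, since negation is available. *)
Lemma tp_cvgP (f : I -> tpspace e) (p : tpspace e) phi :
  f @ F --> p -> tp_set p phi <-> F [set i | tp_set (f i) phi].
Proof.
move=> fp; have H psi : tp_set p psi -> F [set i | tp_set (f i) psi].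
  move=> ppsi; apply: (fp [set q | tp_set q psi]).
  by apply: open_nbhs_nbhs; split; first exact: open_tp.
split=> [|Fphi]; first exact: H.
apply: contrapT => /tpE/H Fn.
have /filter_ex[i [pi ni]] : F ([set i | tp_set (f i) phi] `&`
    [set i | tp_set (f i) (Imp phi Bot)]) by exact: filterI.
by have /tpE := ni.
Qed.

End types.

(** * Limits in the Ellis semigroup realized in the bigger monster model *)

Section monster.
Context {L : language} {T : theory L} (P : monster_pair T).

Notation C := (mC P).
Notation C' := (mC' P).
Notation c := (cbar P).
Notation K := (degC' P).
Notation act := (@Defs.act L T P).

Let C'sat : saturated K C'. Proof. exact: monster_sat (mC'_monster P). Qed.
Let C'hom : strongly_homogeneous K C'. Proof. exact: monster_hom (mC'_monster P). Qed.
Let Klim : strong_limit K. Proof. exact: monster_limit (mC'_monster P). Qed.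

(** With C itself as the small model, [S_cbar] and [fhat] become instances of the type spaces and of
    [gal_of_type]. *)
Definition cmodel : small_model P := SmallModel c (mC_small P).

Lemma aut_of_type (D : Type) (a b : D -> C') : card_lt D K -> same_type a b ->
  exists s : aut C', s \o a = b.
Proof. by move=> DK; apply: homogeneous_tuple DK. Qed.

Lemma tp_realized (m : small_model P) (p : tpspace (sm_emb m)) :
  exists s : aut C', tp (s \o sm_emb m) (sm_emb m) = tp_set p.
Proof.
have [a ae pE] := tp_setP p.
have [|s sE] := @aut_of_type m (sm_emb m) a (sm_small m).
  by move=> phi; rewrite ae.
by exists s; rewrite sE pE.
Qed.

(** Homogeneity gives [g] fixing the model and carrying its image under [s1] to its image under
    [s2]. Then [s1^-1 s2] is a conjugate of [g] times [s1^-1 g^-1 s2], which fixes the model. *)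
Lemma pi_gal_eq (m : small_model P) (s1 s2 : aut C') :
  tp (s1 \o sm_emb m) (sm_emb m) = tp (s2 \o sm_emb m) (sm_emb m) ->
  \pi_(galL P) s1 = \pi_(galL P) s2.
Proof.
move=> s12.
have MK : card_lt (m + m) K by apply: card_lt_sum => //; exact: sm_small.
have [|g gE] := @aut_of_type _ (sum_val (s1 \o sm_emb m) (sm_emb m))
    (sum_val (s2 \o sm_emb m) (sm_emb m)) MK.
  by move=> phi; have /(congr1 (fun S => S phi)) := s12; rewrite /tp /= => ->.
have gs x : g (s1 (sm_emb m x)) = s2 (sm_emb m x).
  exact: (congr1 (fun f => f (inl x)) gE).
have gm x : g (sm_emb m x) = sm_emb m x.
  exact: (congr1 (fun f => f (inr x)) gE).
apply/quot_eqP.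
have [[_ NM _] NJ] := nsetP (autfL P).
have gen s : autf_gen s -> nset (autfL P) s by move=> Hs N [_]; apply.
have -> : (s1^-1 * s2 = (s1^-1 * g * s1^-1^-1) * (s1^-1 * g^-1 * s2))%g.
  by rewrite invgK !mulgA mulgK mulgK.
apply: NM; first by apply: NJ; apply: gen; exists m.
apply: gen; exists m => x.
rewrite -[LHS]/(aut_inv s1 (aut_inv g (s2 (sm_emb m x)))).
by rewrite -gs !aut_funK.
Qed.

Lemma gal_of_typeE (m : small_model P) (p : tpspace (sm_emb m)) (s : aut C') :
  tp (s \o sm_emb m) (sm_emb m) = tp_set p -> gal_of_type p = \pi_(galL P) s.
Proof.
move=> sp; apply: (@pi_gal_eq m); rewrite sp.
exact: (xgetI 1%g (P := [set s : aut C' | tp (s \o sm_emb m) (sm_emb m) = p]) sp).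
Qed.

Lemma fhatE (x : selfmap P) (s : aut C') :
  tp (s \o c) c = tp_set (pi0 x) -> fhat x = \pi_(galL P) s.
Proof. exact: (@gal_of_typeE cmodel). Qed.

(** The extension [g'] moves realization and parameters together, and the renaming by [g^-1] in
    [act] undoes the move of the parameters. *)
Lemma tp_act (g : aut C) (g' s : aut C') (p : S_cbar P) :
  (forall x, g' (c x) = c (g x)) -> tp (s \o c) c = tp_set p ->
  tp (g' \o (s \o c)) c = tp_set (act g p).
Proof.
move=> g'E sp; apply/funext => phi; apply/propext.
rewrite /= /act_set /= -sp /tp /= sat_rename [X in _ <-> X](aut_sat g').
suff -> : g' \o (sum_val (s \o c) c \o act_rename g) = sum_val (g' \o (s \o c)) c by [].
by apply/funext => -[x|b] //=; rewrite g'E; congr (c _); exact: aut_invK.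
Qed.

Section ultralimits.
Context {I : Type} {F : set_system I} {FU : UltraFilter F}.

(** The parameters are constant along the ultrafilter, so they may be prescribed as their own
    limit. *)
Lemma realize_over (X B : Type) (a : I -> X -> C') (e : B -> C') :
  card_lt X K -> card_lt B K -> exists b : X -> C', forall phi : formula L (X + B),
    sat (sum_val b e) phi <-> F [set i | sat (sum_val (a i) e) phi].
Proof.
move=> XK BK; have XBK : card_lt (X + B) K by exact: card_lt_sum.
have [|b [bE be]] := @realize_ultra L I (X + B) B K F (fun=> C')
    (fun i => sum_val (a i) e) C' inr e FU C'sat XBK.
  by move=> psi; apply: iff_sym; exact: ultra_const.
exists (b \o inl) => phi; rewrite -bE; suff -> : sum_val (b \o inl) e = b by [].
by apply/funext => -[x|x] //=; rewrite -be.
Qed.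

Lemma tp_ultra_cvg (m : small_model P) (f : I -> tpspace (sm_emb m)) :
  exists p : tpspace (sm_emb m), f @ F --> p.
Proof.
have aP i : exists a, same_type a (sm_emb m) /\ tp_set (f i) = tp a (sm_emb m).
  by have [a ? ?] := tp_setP (f i); exists a.
have [a aE] := choice aP.
have [b bE] := realize_over a (sm_emb m) (sm_small m) (sm_small m).
have be : same_type b (sm_emb m).
  move=> phi; have /= := bE (rename inl phi).
  under eq_set do rewrite (propext (sat_rename _ _ _)) sum_val_inl.
  rewrite sat_rename sum_val_inl => ->.
  under eq_set do rewrite (propext ((aE _).1 _)).
  exact: ultra_const.
have pP : exists2 b', same_type b' (sm_emb m) & tp b (sm_emb m) = tp b' (sm_emb m).
  by exists b.
exists (TpSpace pP); apply: tp_cvg => phi /bE.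
by apply: filterS => i; rewrite /= (aE i).2.
Qed.

Lemma selfmap_cvgP (x : I -> selfmap P) (x0 : selfmap P) : x @ F --> x0 <->
  forall p phi, tp_set (x0 p) phi <-> F [set i | tp_set (x i p) phi].
Proof.
split=> [xx0 p phi|H].
  apply: (@tp_cvgP _ _ _ _ _ _ _ (fun i => x i p)).
  apply: (@cvg_comp _ _ _ x (fun y : selfmap P => y p) _ _ _ xx0).
  exact: (@proj_continuous (S_cbar P) (fun=> S_cbar P) p x0).
by apply: ptws_cvgP => p; apply: tp_cvg => phi /H.
Qed.

Lemma selfmap_ultra_cvg (x : I -> selfmap P) : exists x0 : selfmap P, x @ F --> x0.
Proof.
have x0P p : exists q : S_cbar P, (fun i => x i p) @ F --> q by exact: (@tp_ultra_cvg cmodel).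
have [x0 x0E] := choice x0P; exists x0.
exact: ptws_cvgP.
Qed.

Lemma selfmap_cvg_unique (x : I -> selfmap P) (x0 x1 : selfmap P) :
  x @ F --> x0 -> x @ F --> x1 -> x0 = x1.
Proof.
move=> /selfmap_cvgP x0E /selfmap_cvgP x1E; apply/funext => p.
by apply/tpspace_eq/seteqP; split=> phi; rewrite x0E x1E.
Qed.

Lemma compr_cvg (x : I -> selfmap P) (x0 q : selfmap P) :
  x @ F --> x0 -> (fun i => x i \o q : selfmap P) @ F --> (x0 \o q : selfmap P).
Proof. by move=> /selfmap_cvgP H; apply/selfmap_cvgP => p phi; exact: H. Qed.

Lemma EL_cvg (x : I -> selfmap P) (x0 : selfmap P) :
  F [set i | EL (x i)] -> x @ F --> x0 -> EL x0.
Proof. by move=> FE; apply: closed_cvg_ultra => //; exact: closed_closure. Qed.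

(* The automorphisms [g i] are applied to the pair [(d, s i d)], whose type
   survives in the limit. *)
Lemma limit_pair (g : I -> aut C) (x : I -> selfmap P) (s : I -> aut C')
    (r eta : selfmap P) (D : Type) (d : D -> C') :
  card_lt D K -> (act \o g : I -> selfmap P) @ F --> r ->
  (fun i => act (g i) \o x i : selfmap P) @ F --> eta ->
  (forall i, tp (s i \o c) c = tp_set (pi0 (x i))) ->
  exists t v : aut C', [/\ tp (t \o c) c = tp_set (pi0 r),
    tp (v \o c) c = tp_set (pi0 eta)
    & forall phi : formula L (D + D), sat (sum_val (t \o d) (v \o d)) phi <->
        F [set i | sat (sum_val d (s i \o d)) phi]].
Proof.
move=> DK /selfmap_cvgP gr /selfmap_cvgP geta sE.
have [g' g'E] := choice (fun i => aut_extend (g i)).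
have CK : card_lt C K := mC_small P.
have XK : card_lt (C + D) K by exact: card_lt_sum.
(* [c] is carried along with [d], so that the same [t] and [v] account for the types over C and for
   the relative position of the images of [d]. *)
pose e : C + D -> C' := sum_val c d.
pose a i := sum_val (g' i \o e) (g' i \o (s i \o e)).
have [b bE] := realize_over a c (card_lt_sum Klim XK XK) CK.
have bX (Y : Type) (k : Y -> (C + D) + (C + D) + C) w (v : I -> Y -> C')
    (phi : formula L Y) :
    w = sum_val b c \o k -> (forall i, v i = sum_val (a i) c \o k) ->
    sat w phi <-> F [set i | sat (v i) phi].
  move=> -> vE; rewrite -sat_rename bE.
  by under eq_set do rewrite (propext (sat_rename _ _ _)) -vE.
have lim (v : I -> C + D -> C') phi : (forall i, same_type e (v i)) ->
    sat e phi <-> F [set i | sat (v i) phi].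
  move=> ev; under [X in _ <-> F X]eq_set do rewrite -(propext (ev _ _)).
  by apply: iff_sym; exact: ultra_const.
have [t tE] : exists t : aut C', t \o e = b \o inl.
  apply: aut_of_type => // phi.
  rewrite (bX _ (inl \o inl) (b \o inl) (fun i => g' i \o e))//.
  by apply: lim => i psi; exact: aut_sat.
have [v vE] : exists v : aut C', v \o e = b \o inr.
  apply: aut_of_type => // phi.
  rewrite (bX _ (inl \o inr) (b \o inr) (fun i => g' i \o (s i \o e)))//.
  by apply: lim => i psi; rewrite (aut_sat (s i)); exact: aut_sat.
have tX z : t (e z) = b (inl z) by rewrite -[LHS]/((t \o e) z) tE.
have vX z : v (e z) = b (inr z) by rewrite -[LHS]/((v \o e) z) vE.
exists t, v; split.
- apply/seteqP; suff H phi : tp (t \o c) c phi <-> tp_set (pi0 r) phi.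
    by split=> phi /H.
  rewrite gr; pose k (z : C + C) : (C + D) + (C + D) + C :=
    match z with inl x => inl (inl (inl x)) | inr x => inr x end.
  rewrite (_ : [set i | _] = [set i | sat (sum_val (g' i \o c) c) phi]); last first.
    apply/funext => i; apply: (congr1 (fun S => S phi) (esym _)).
    exact: (@tp_act _ _ 1%g (tp_refl c) (g'E i)).
  by apply: (bX _ k) => [|i]; apply/funext => -[z|z] //=; rewrite -tX.
- apply/seteqP; suff H phi : tp (v \o c) c phi <-> tp_set (pi0 eta) phi.
    by split=> phi /H.
  rewrite geta; pose k (z : C + C) : (C + D) + (C + D) + C :=
    match z with inl x => inl (inr (inl x)) | inr x => inr x end.
  rewrite (_ : [set i | _] =
      [set i | sat (sum_val (g' i \o (s i \o c)) c) phi]); last first.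
    apply/funext => i; apply: (congr1 (fun S => S phi) (esym _)).
    exact: tp_act (g'E i) (sE i).
  by apply: (bX _ k) => [|i]; apply/funext => -[z|z] //=; rewrite -vX.
(* Applying [g' i] to both components does not change their joint type. *)
- move=> phi; pose k (z : D + D) : (C + D) + (C + D) + C :=
    match z with inl x => inl (inl (inr x)) | inr x => inl (inr (inr x)) end.
  rewrite (bX _ k _ (fun i => g' i \o sum_val d (s i \o d))).
  + by under eq_set do rewrite -(propext (aut_sat _ _ _)).
  + by apply/funext => -[z|z] //=; rewrite -?tX -?vX.
  + by move=> i; apply/funext => -[z|z].
Qed.

End ultralimits.

Lemma EL_ultra (x : selfmap P) : EL x ->
  exists F : set_system (aut C), UltraFilter F /\ (act : aut C -> selfmap P) @ F --> x.
Proof. by move=> /closure_ultra[F [FU _ Fx]]; exists F. Qed.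

(** Along automorphisms tending to [x], with a fixed [s] realizing [pi0 y], the limit pair has the
    type of [(c, s c)]. So one automorphism [k] realizes [pi0 x] while [k s] realizes the type of
    the product. *)
Lemma fhatM (x y : selfmap P) : EL x -> EL y ->
  fhat (x \o y : selfmap P) = (fhat x * fhat y)%g.
Proof.
move=> /EL_ultra[F [FU Fx]] ELy.
have [s sE] := @tp_realized cmodel (pi0 y).
have Fxy : (fun g => act g \o y : selfmap P) @ F --> (x \o y : selfmap P).
  exact: compr_cvg.
have [t [v [tE vE tv]]] := limit_pair c (mC_small P) Fx Fxy (fun=> sE).
have [k kE] : exists k : aut C', k \o sum_val c (s \o c) = sum_val (t \o c) (v \o c).
  apply: aut_of_type => [|phi]; first by apply: card_lt_sum => //; exact: mC_small.
  by rewrite tv ultra_const.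
have xk : fhat x = \pi_(galL P) k.
  apply: fhatE; rewrite -tE; congr tp; apply/funext => z.
  exact: (congr1 (fun f => f (inl z)) kE).
have xyks : fhat (x \o y : selfmap P) = \pi_(galL P) (k * s)%g.
  apply: fhatE; rewrite -vE; congr tp; apply/funext => z.
  exact: (congr1 (fun f => f (inr z)) kE).
by rewrite xk xyks (fhatE sE) -[RHS]/(quotM _ _) piM.
Qed.

End monster.

(** * The τ-topology *)

Section ellis_group_topology.
Context {L : language} {T : theory L} {P : monster_pair T} (E : ellis_data P).

Notation C := (mC P).
Notation C' := (mC' P).
Notation c := (cbar P).
Notation K := (degC' P).
Notation act := (@Defs.act L T P).
Notation u := (idem E).
Notation G := (ellis_group E).
Notation eg_val := (@Defs.eg_val L T P E).

Lemma ideal_EL x : ideal E x -> EL x.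
Proof. by have [[IE _ _] _] := idealP E; exact: IE. Qed.

Lemma idealM x y : EL x -> ideal E y -> ideal E (x \o y).
Proof. by have [[_ _ H] _] := idealP E; exact: H. Qed.

(** The products [y \o u] form a left ideal inside [ideal E], hence all of it by minimality. *)
Lemma ideal_idemr x : ideal E x -> x \o u = x.
Proof.
have [[_ _ IM] Imin] := idealP E; move=> Ix.
have Iu := idem_in E.
suff E' : [set y \o u | y in ideal E] = ideal E.
  by move: Ix; rewrite -{1}E' => -[y _ <-]; rewrite -[LHS]compA idemP.
apply: Imin => [|_ [y Iy <-]]; last by apply: idealM => //; exact: ideal_EL.
split=> [_ [y Iy <-]||y _ ELy [z Iz <-]].
- by apply: ideal_EL; apply: idealM => //; exact: ideal_EL.
- by exists (u \o u), u.
- by exists (y \o z); [exact: idealM|].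
Qed.

Lemma eg_ideal (x : G) : ideal E x.
Proof.
by have [m Im <-] := eg_in x; apply: idealM => //; exact/ideal_EL/idem_in.
Qed.

Lemma eg_EL (x : G) : EL x.
Proof. exact/ideal_EL/eg_ideal. Qed.

Lemma eg_of_ideal (y : selfmap P) : ideal E y -> exists x : G, eg_val x = u \o y.
Proof. by move=> Iy; exists (@EllisGroup _ _ _ E (u \o y) (ex_intro2 _ _ y Iy erefl)). Qed.

Lemma eg_idemr (x : G) : eg_val x \o u = eg_val x.
Proof. exact/ideal_idemr/eg_ideal. Qed.

Lemma eg_valK (x : G) : eg_val x^-1%g \o eg_val x = u.
Proof. exact: (congr1 eg_val (mulVg x)). Qed.

Section ultralimits.
Context {I : Type} {F : set_system I} {FU : UltraFilter F}.

(** Right multiplication by [u] is continuous and is the identity on the ideal, so it fixes the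
    limit, which is thus a multiple of [u]. *)
Lemma ideal_cvg (x : I -> selfmap P) (x0 : selfmap P) :
  F [set i | ideal E (x i)] -> x @ F --> x0 -> ideal E x0.
Proof.
move=> FI xx0.
have FE : F [set i | EL (x i)] by apply: filterS FI => i; exact: ideal_EL.
suff <- : x0 \o u = x0 by apply: idealM (idem_in E); exact: EL_cvg xx0.
suff xu : (fun i => x i \o u : selfmap P) @ F --> x0.
  exact: selfmap_cvg_unique (compr_cvg (q := u) xx0) xu.
apply: cvg_trans xx0; apply: near_eq_cvg.
by apply: filterS FI => i /ideal_idemr.
Qed.

Lemma tau_cvg (y : I -> G) (b : G) :
  (forall S : set G, F (y @^-1` S) -> circ u (eg_val @` S) b) -> y @ F --> b.
Proof.
move=> H; apply: ultra_cvg_open => U oU Ub FnU.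
have := oU b; apply => //; split; [exact: H|exact: eg_in].
Qed.

(** Since [u] is [a^-1 x0] and [a^-1 z] is [a^-1 z0], products [k h] with [k] near [a^-1] and [h]
    near [x i] come near [u], while [k h y_i] comes near [a^-1 z]. This is what [circ] asks for. *)
Lemma tau_cvg_division (x : I -> selfmap P) (y : I -> G) (x0 z0 : selfmap P)
    (a z : G) :
  (forall i, EL (x i)) -> x @ F --> x0 ->
  (fun i => x i \o eg_val (y i) : selfmap P) @ F --> z0 ->
  eg_val a = u \o x0 -> eg_val z = u \o z0 -> y @ F --> (a^-1 * z)%g.
Proof.
move=> ELx xx0 xyz0 aE zE; apply: tau_cvg => S FS.
apply/circP; split; first exact: eg_EL.
have uE : u = eg_val a^-1%g \o x0.
  by rewrite -(eg_valK a) aE [LHS]compA eg_idemr.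
have bE : eg_val (a^-1 * z)%g = eg_val a^-1%g \o z0.
  by rewrite -[LHS]/(eg_val a^-1%g \o eg_val z) zE [LHS]compA eg_idemr.
move=> V W; rewrite !nbhsE => -[V' [oV V'u] V'V] [W' [oW W'b] W'W].
have nV (t : selfmap P) : V' t -> nbhs t V' by move=> ?; exact: open_nbhs_nbhs.
have nW (t : selfmap P) : W' t -> nbhs t W' by move=> ?; exact: open_nbhs_nbhs.
rewrite uE in V'u; rewrite bE in W'b.
have kV : nbhs (eg_val a^-1%g) [set t : selfmap P | V' (t \o x0)].
  by apply: compr_continuous; exact: nV.
have kW : nbhs (eg_val a^-1%g) [set t : selfmap P | W' (t \o z0)].
  by apply: compr_continuous; exact: nW.
(* The order matters: [k] first, then the index [i], then [h]. Once [k] is an automorphism, left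
   multiplication by it is continuous. *)
have [k [Vk Wk]] := ELP (@eg_EL a^-1%g) (filterI kV kW).
have FV : F [set i | V' (act k \o x i)].
  by apply: (xx0 [set t : selfmap P | V' (act k \o t)]); exact: compl_continuous (nV _ Vk).
have FW : F [set i | W' (act k \o (x i \o eg_val (y i)))].
  by apply: (xyz0 [set t : selfmap P | W' (act k \o t)]); exact: compl_continuous (nW _ Wk).
have [i [Si [Vi Wi]]] := filter_ex (filterI FS (filterI FV FW)).
have hV : nbhs (x i) [set t : selfmap P | V' (act k \o t)].
  exact: compl_continuous (nV _ Vi).
have hW : nbhs (x i) [set t : selfmap P | W' (act k \o (t \o eg_val (y i)))].
  exact: (compr_continuous (compl_continuous (nW _ Wi))).
have [h [Vh Wh]] := ELP (ELx i) (filterI hV hW).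
exists (k * h)%g, (eg_val (y i)); rewrite act_mul; split.
- by exists (y i).
- exact: V'V.
- exact: W'W.
Qed.

Lemma tau_cvg_idem (x : I -> G) (x0 : selfmap P) (z : G) :
  (fun i => eg_val (x i)) @ F --> x0 -> eg_val z = u \o x0 -> x @ F --> z.
Proof.
move=> xx0 zE; have -> : z = (1^-1 * z)%g by rewrite invg1 mul1g.
have Eu : EL u by apply: ideal_EL; exact: idem_in.
apply: (@tau_cvg_division (fun=> u) x u x0 1%g z) => //; last by rewrite idemP.
- exact: cvg_cst.
- suff -> : (fun i => u \o eg_val (x i) : selfmap P) = (fun i => eg_val (x i)) by [].
  by apply/funext => i; exact: (congr1 eg_val (mul1g (x i))).
Qed.

(** Limits of [x] and of the product are taken in the Ellis semigroup, and the limit of [y] is their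
    quotient. Limits in the τ-topology need not be unique, so this choice is what makes them
    compatible. *)
Lemma tau_cvgM (x y : I -> G) : exists a b : G,
  [/\ x @ F --> a, y @ F --> b & (fun i => x i * y i)%g @ F --> (a * b)%g].
Proof.
have [x0 xx0] := selfmap_ultra_cvg (fun i => eg_val (x i)).
have [z0 zz0] := selfmap_ultra_cvg (fun i => eg_val (x i * y i)%g).
have Ix0 : ideal E x0.
  by apply: ideal_cvg xx0; apply: filterE => i; exact: eg_ideal.
have Iz0 : ideal E z0.
  by apply: ideal_cvg zz0; apply: filterE => i; exact: eg_ideal.
have [a aE] := eg_of_ideal Ix0; have [z zE] := eg_of_ideal Iz0.
exists a, (a^-1 * z)%g; split.
- exact: tau_cvg_idem xx0 aE.
- by apply: (tau_cvg_division _ xx0 zz0 aE zE) => i; exact: eg_EL.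
- by rewrite mulVKg; exact: tau_cvg_idem zz0 zE.
Qed.

(** Neighborhoods of two limits of one ultrafilter always meet; translating by [a^-1] moves this to
    neighborhoods of 1. *)
Lemma tau_cvg_H (x : I -> G) (a b : G) :
  x @ F --> a -> x @ F --> b -> H_uM_set (a^-1 * b)%g.
Proof.
move=> xa xb; apply/H_uM_setP => V U oV oU V1 Ub.
have nV : nbhs a [set t | V (a^-1 * t)%g].
  by apply: open_nbhs_nbhs; split; [exact: open_mull|rewrite /= mulVg].
have nU : nbhs b [set t | U (a^-1 * t)%g].
  by apply: open_nbhs_nbhs; split; [exact: open_mull|].
have [t [Vt Ut]] := filter_ex (filterI (xa _ nV) (xb _ nU)).
by exists (a^-1 * t)%g.
Qed.

End ultralimits.

(** This is the idempotence of the τ-closure: two successive approximations by automorphisms [k] and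
    [h] near [u] compose, because [u] is idempotent. *)
Lemma cl_tau_closed (S : set G) : closed [set x : G | circ u (eg_val @` S) x].
Proof.
rewrite -[X in closed X]setCK closedC tau_openE => x.
rewrite setCK => -[/circP[ELx cx] ux]; apply/circP; split=> // V W uV xW.
have [V' [oV V'u V'V]] : exists V', [/\ open V', V' u & V' `<=` V].
  by move: uV; rewrite nbhsE => -[V' [oV V'u] V'V]; exists V'.
have [W' [oW W'x W'W]] : exists W', [/\ open W', W' (eg_val x) & W' `<=` W].
  by move: xW; rewrite nbhsE => -[W' [oW W'x] W'W]; exists W'.
have nV (t : selfmap P) : V' t -> nbhs t V' by move=> ?; exact: open_nbhs_nbhs.
have nW (t : selfmap P) : W' t -> nbhs t W' by move=> ?; exact: open_nbhs_nbhs.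
have uV' : nbhs u [set t : selfmap P | V' (t \o u)].
  by apply: compr_continuous; apply: nV; rewrite idemP.
have [k [_ [[y cy <-] Vk Wk]]] := cx _ _ uV' (nW _ W'x).
have [_ {}cy] := (circP _ _ _).1 cy.
have [h [_ [[z Sz <-] Vh Wh]]] := cy _ _ (compl_continuous (nV _ Vk))
  (compl_continuous (nW _ Wk)).
exists (k * h)%g, (eg_val z); rewrite act_mul; split; [by exists z|exact: V'V|exact: W'W].
Qed.

Lemma circ_self (S : set G) x : S x -> circ u (eg_val @` S) (eg_val x).
Proof.
move=> Sx; apply/circP; split; first exact: eg_EL.
move=> V W uV xW; have Eu : EL u by apply: ideal_EL; exact: idem_in.
have uW : nbhs u [set t : selfmap P | W (t \o eg_val x)].
  apply: compr_continuous; suff -> : u \o eg_val x = eg_val x by [].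
  exact: (congr1 eg_val (mul1g x)).
have [g [Vg Wg]] := ELP Eu (filterI uV uW).
by exists g, (eg_val x); split=> //; exists x.
Qed.

(** By the definition of the τ-closure, some ultrafilter on pairs [(g, i)] above [F] has [g] tending
    to [u] and [g y_i] tending to [b]; [limit_pair] applies to it. *)
Lemma tau_limit_pair (I : Type) (F : set_system I) (y : I -> G) (b : G)
    (s : I -> aut C') (D : Type) (d : D -> C') :
  UltraFilter F -> card_lt D K -> y @ F --> b ->
  (forall i, tp (s i \o c) c = tp_set (pi0 (y i))) ->
  exists t v : aut C', [/\ tp (t \o c) c = tp_set (pi0 u),
    tp (v \o c) c = tp_set (pi0 b)
    & forall phi : formula L (D + D), sat (sum_val (t \o d) (v \o d)) phi <->
        F [set i | sat (sum_val d (s i \o d)) phi]].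
Proof.
move=> FU DK yb sE.
have cb S : F S -> circ u (eg_val @` (y @` S)) b.
  move=> FS; suff : [set x : G | circ u (eg_val @` (y @` S)) x] b by [].
  apply: (closed_cvg_ultra (F := F) _ (@cl_tau_closed (y @` S)) _ yb).
  by apply: filterS FS => i Si; apply: circ_self; exists i.
have [|V V' [nV1 nV2 FV] [nV1' nV2' FV']||H [HU HB]] :=
    @ultra_base (aut C * I) (set (selfmap P) * set (selfmap P) * set I)
      [set z | [/\ nbhs u z.1.1, nbhs (eg_val b) z.1.2 & F z.2]]
      (fun z => [set gi | [/\ z.1.1 (act gi.1), z.1.2 (act gi.1 \o eg_val (y gi.2))
                          & z.2 gi.2]]).
- by exists (setT, setT, setT); split; exact: filterT.
- exists (V.1.1 `&` V'.1.1, V.1.2 `&` V'.1.2, V.2 `&` V'.2).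
    by split; exact: filterI.
  by move=> gi [[? ?] [? ?] [? ?]].
- move=> [[V W] S] [/= nV nW /cb/circP[_ /(_ _ _ nV nW)]].
  by move=> [g [_ [[_ [i Si <-] <-] Vg Wg]]]; exists (g, i).
have uT : nbhs u setT by exact: filterT.
have bT : nbhs (eg_val b) setT by exact: filterT.
have FT : F setT by exact: filterT.
have gu : (act \o (fun gi : aut C * I => gi.1) : _ -> selfmap P) @ H --> u.
  move=> V uV; have HV : H [set gi : aut C * I | V (act gi.1)].
    by apply: filterS (HB (V, setT, setT) _) => [gi []|//].
  exact: HV.
have gb : (fun gi : aut C * I => act gi.1 \o eg_val (y gi.2) : selfmap P) @ H -->
    eg_val b.
  move=> W bW; have HW : H [set gi : aut C * I | W (act gi.1 \o eg_val (y gi.2))].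
    by apply: filterS (HB (setT, W, setT) _) => [gi []|//].
  exact: HW.
have [t [v [tE vE tv]]] := limit_pair d DK gu gb (fun gi => sE gi.2).
exists t, v; split=> // phi; rewrite tv.
(* [H] projects to [F], so the joint type may be read along [F]. *)
have HF S : F S -> H [set gi | S gi.2].
  by move=> FS; apply: filterS (HB (setT, setT, S) _) => [gi []|//].
split=> [Hphi|Fphi]; last exact: HF Fphi.
have [//|/HF Hn] := in_ultra_setVsetC [set i | sat (sum_val d (s i \o d)) phi] FU.
by have [gi []] := filter_ex (filterI Hphi Hn).
Qed.

Lemma f_uMM (x y : G) : f_uM (x * y)%g = (f_uM x * f_uM y)%g.
Proof. by apply: fhatM; exact: eg_EL. Qed.

Lemma f_uM1 : f_uM (1 : G)%g = 1%g.
Proof. by apply: (@mulgI _ (f_uM (1 : G)%g)); rewrite -f_uMM !mulg1. Qed.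

Lemma fhat_idem : fhat u = 1%g.
Proof. exact: f_uM1. Qed.

Lemma f_uMV (x : G) : f_uM x^-1%g = (f_uM x)^-1%g.
Proof. by apply: (@mulgI _ (f_uM x)); rewrite -f_uMM !mulgV f_uM1. Qed.

Lemma pi_galM (s t : aut C') :
  \pi_(galL P) (s * t)%g = (\pi_(galL P) s * \pi_(galL P) t)%g.
Proof. by rewrite -[RHS]/(quotM _ _) piM. Qed.

(* An ultrafilter tending to both 1 and h yields two pairs of tuples of the same
   type, whose relative positions are given by 1 and h respectively. *)
Lemma f_uM_H (h : G) : H_uM_set h -> f_uM h = 1%g.
Proof.
move=> Hh.
have [|V V' [nV1 nV2] [nV1' nV2']||F [FU FB]] :=
    @ultra_base G (set G * set G)
      [set z | nbhs (1%g : G) z.1 /\ nbhs h z.2] (fun z => z.1 `&` z.2).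
- by exists (setT, setT); split; exact: filterT.
- exists (V.1 `&` V'.1, V.2 `&` V'.2).
    by split; exact: filterI.
  by move=> x [[? ?] [? ?]].
- by move=> [V W] [/= nV nW]; exact: Hh.
have F1 : id @ F --> (1%g : G).
  move=> V nV; have FV := FB (V, setT) (conj nV (@filterT _ _ (nbhs_filter h))).
  suff : F V by []; by apply: filterS FV => x [].
have Fh : id @ F --> h.
  move=> V nV; have FV := FB (setT, V) (conj (@filterT _ _ (nbhs_filter (1%g : G))) nV).
  suff : F V by []; by apply: filterS FV => x [].
have [s sE] := choice (fun x : G => @tp_realized _ _ _ (cmodel P) (pi0 (eg_val x))).
have [t1 [v1 [t1E v1E tv1]]] := tau_limit_pair c FU (mC_small P) F1 sE.
have [t [v [tE vE tv]]] := tau_limit_pair c FU (mC_small P) Fh sE.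
have [k kE] : exists k : aut C',
    k \o sum_val (t1 \o c) (v1 \o c) = sum_val (t \o c) (v \o c).
  apply: aut_of_type => [|phi]; last by rewrite tv1 tv.
  by apply: card_lt_sum; [exact: monster_limit (mC'_monster P)|exact: mC_small..].
have kt : k \o (t1 \o c) = t \o c.
  by apply/funext => x; exact: (congr1 (fun f => f (inl x)) kE).
have kv : k \o (v1 \o c) = v \o c.
  by apply/funext => x; exact: (congr1 (fun f => f (inr x)) kE).
(* [t1], [v1] and [t] all realize [pi0 u], whose class is trivial; hence so is the class of [k], and
   with it that of [v]. *)
have Et1 : \pi_(galL P) t1 = 1%g by rewrite -(fhatE t1E) fhat_idem.
have Ev1 : \pi_(galL P) v1 = 1%g by rewrite -(fhatE v1E); exact: f_uM1.
have Ek : \pi_(galL P) (k * t1)%g = 1%g.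
  by rewrite -fhat_idem; apply/esym/fhatE; rewrite -tE -kt.
have {}Ek : \pi_(galL P) k = 1%g by move: Ek; rewrite pi_galM Et1 mulg1.
have -> : f_uM h = \pi_(galL P) (k * v1)%g by apply: fhatE; rewrite -vE -kv.
by rewrite pi_galM Ek Ev1 mulg1.
Qed.

End ellis_group_topology.

(** * The quotient map from the Ellis group to the Galois group *)

Lemma closed_ultra (T : topologicalType) (A : set T) :
  (forall F x, UltraFilter F -> F A -> id @ F --> x -> A x) -> closed A.
Proof.
move=> H x clx; have clx' : closure (id @` A) x by rewrite image_id.
by have [F [FU FA Fx]] := closure_ultra clx'; exact: H FU FA Fx.
Qed.

Section galois.
Context {L : language} {T : theory L} {P : monster_pair T} (E : ellis_data P).

Notation C := (mC P).
Notation C' := (mC' P).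
Notation c := (cbar P).
Notation K := (degC' P).
Notation act := (@Defs.act L T P).
Notation u := (idem E).
Notation G := (ellis_group E).
Notation eg_val := (@Defs.eg_val L T P E).

Let CK : card_lt C K := mC_small P.
Let Klim : strong_limit K. Proof. exact: monster_limit (mC'_monster P). Qed.

Lemma pi_galV (s : aut C') : \pi_(galL P) s^-1%g = (\pi_(galL P) s)^-1%g.
Proof. by rewrite -[RHS]/(quotV _) piV. Qed.

(* As [v v = v], the limits of the two components of [(c, s c)] have the same type
   over [C]. *)
Lemma idempotent_conjugate (v : selfmap P) (s : aut C') :
  EL v -> v \o v = v -> tp (s \o c) c = tp_set (pi0 v) ->
  exists k : aut C', tp c (k \o c) = tp (s \o c) (k \o c).
Proof.
move=> ELv vv sE; have [F [FU Fv]] := EL_ultra ELv.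
have Fvv : (fun g => act g \o v : selfmap P) @ F --> v.
  by rewrite -[X in _ --> X]vv; exact: compr_cvg.
have [t [w [tE wE tw]]] := limit_pair c CK Fv Fvv (fun=> sE).
have [k kE] : exists k : aut C', k \o sum_val c (s \o c) = sum_val (t \o c) (w \o c).
  apply: aut_of_type => [|phi]; first exact: card_lt_sum.
  by rewrite tw ultra_const.
have kt : k \o c = t \o c.
  by apply/funext => x; exact: (congr1 (fun f => f (inl x)) kE).
have kw : k \o (s \o c) = w \o c.
  by apply/funext => x; exact: (congr1 (fun f => f (inr x)) kE).
exists k^-1%g.
have kV a phi : tp a (k^-1%g \o c) phi <-> tp (k \o a) c phi.
  rewrite /tp /= (aut_sat k).
  suff -> : k \o sum_val a (k^-1%g \o c) = sum_val (k \o a) c by [].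
  by apply/funext => -[x|x] //=; exact: (aut_invK k).
by apply/seteqP; split=> phi; rewrite !kV kt kw tE wE.
Qed.

(** Each [s i c] has the type of [c] over [k i c]. In the limit, a realization of [pi0 v0] has the
    type of [c] over the conjugate [t c], so it is the image of [c] under an automorphism [r] fixing
    that model pointwise. *)
Lemma fhat_limit_idempotents (I : Type) (F : set_system I) (v : I -> selfmap P)
    (v0 : selfmap P) : UltraFilter F ->
  (forall i, EL (v i)) -> (forall i, v i \o v i = v i) -> v @ F --> v0 ->
  fhat v0 = 1%g.
Proof.
move=> FU ELv vv vv0.
have [s sE] := choice (fun i => @tp_realized _ _ _ (cmodel P) (pi0 (v i))).
have [k kE] := choice (fun i => idempotent_conjugate (ELv i) (vv i) (sE i)).
have [b bE] := realize_over (fun i => sum_val (k i \o c) (s i \o c)) c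
  (card_lt_sum Klim CK CK) CK.
have bX (Y : Type) (h : Y -> (C + C) + C) w (a : I -> Y -> C') (phi : formula L Y) :
    w = sum_val b c \o h ->
    (forall i, a i = sum_val (sum_val (k i \o c) (s i \o c)) c \o h) ->
    sat w phi <-> F [set i | sat (a i) phi].
  move=> -> aE; rewrite -sat_rename bE.
  by under eq_set do rewrite (propext (sat_rename _ _ _)) -aE.
have [t tE] : exists t : aut C', t \o c = b \o inl.
  apply: aut_of_type => // phi.
  rewrite (bX _ (inl \o inl) (b \o inl) (fun i => k i \o c))//.
  under eq_set do rewrite -(propext (aut_sat _ _ _)).
  by apply: iff_sym; exact: ultra_const.
have tX x : t (c x) = b (inl x) by rewrite -[LHS]/((t \o c) x) tE.
have [r rE] : exists r : aut C',
    r \o sum_val c (t \o c) = sum_val (b \o inr) (t \o c).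
  apply: aut_of_type => [|phi]; first exact: card_lt_sum.
  pose h1 (z : C + C) : (C + C) + C :=
    match z with inl x => inr x | inr x => inl (inl x) end.
  pose h2 (z : C + C) : (C + C) + C :=
    match z with inl x => inl (inr x) | inr x => inl (inl x) end.
  rewrite (bX _ h1 (sum_val c (t \o c)) (fun i => sum_val c (k i \o c))).
  - rewrite (bX _ h2 (sum_val (b \o inr) (t \o c)) (fun i => sum_val (s i \o c) (k i \o c))).
    + suff -> : [set i | sat (sum_val c (k i \o c)) phi] =
        [set i | sat (sum_val (s i \o c) (k i \o c)) phi] by [].
      by apply/funext => i; exact: (congr1 (fun S => S phi) (kE i)).
    + by apply/funext => -[x|x] /=.
    + by move=> i; apply/funext => -[x|x].
  - by apply/funext => -[x|x] /=.
  - by move=> i; apply/funext => -[x|x].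
have rc x : r (c x) = b (inr x).
  exact: (congr1 (fun f => f (inl x)) rE).
have rt x : r (t (c x)) = t (c x).
  exact: (congr1 (fun f => f (inr x)) rE).
have -> : fhat v0 = \pi_(galL P) r.
  apply: fhatE; apply/seteqP; suff H phi : tp (r \o c) c phi <-> tp_set (pi0 v0) phi.
    by split=> phi /H.
  rewrite ((selfmap_cvgP _ _).1 vv0).
  pose h (z : C + C) : (C + C) + C :=
    match z with inl x => inl (inr x) | inr x => inr x end.
  rewrite /tp /= (bX _ h (sum_val (r \o c) c) (fun i => sum_val (s i \o c) c)).
  - suff -> : [set i | sat (sum_val (s i \o c) c) phi] =
      [set i | tp_set (v i (tp_refl c)) phi] by [].
    by apply/funext => i; exact: (congr1 (fun S => S phi) (sE i)).
  - by apply/funext => -[x|x] //=; exact: rc.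
  - by move=> i; apply/funext => -[x|x].
have : \pi_(galL P) (t^-1 * r * t)%g = \pi_(galL P) 1%g.
  apply: (@pi_gal_eq _ _ _ (cmodel P)); congr tp; apply/funext => x.
  by rewrite -[LHS]/(aut_inv t (r (t (c x)))) rt aut_funK.
rewrite !pi_galM pi_galV -[\pi_(galL P) 1%g]/(1%g : galL P) => H.
apply: (@mulIg _ (\pi_(galL P) t)); apply: (@mulgI _ (\pi_(galL P) t)^-1%g).
by rewrite mulgA H mul1g mulVg.
Qed.

(** The τ-limit obtained from the [u x_i u] differs from [u x0 u] by a factor coming from a limit of
    idempotents, whose class is trivial. *)
Lemma fhat_preimage_cvg (B : set (galL P)) (I : Type) (F : set_system I)
    (x : I -> selfmap P) (x0 : selfmap P) : UltraFilter F ->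
  closed [set p : G | B (f_uM p)] ->
  (forall i, EL (x i)) -> F [set i | B (fhat (x i))] -> x @ F --> x0 -> B (fhat x0).
Proof.
move=> FU Bcl ELx FB xx0.
have Eu : EL u by apply: ideal_EL; exact: idem_in.
have Ey i : ideal E (x i \o u) by apply: idealM => //; exact: idem_in.
have yy0 : (fun i => x i \o u : selfmap P) @ F --> (x0 \o u : selfmap P).
  exact: compr_cvg.
have ELx0 : EL x0 by apply: EL_cvg xx0; apply: filterE.
have [w wE] := choice (fun i => eg_of_ideal (Ey i)).
(* The idempotent of the ideal for which [v i] times [w i] is [x i] times [u]. *)
pose v i : selfmap P := (x i \o u) \o eg_val (w i)^-1%g.
have Iv i : ideal E (v i) by apply: idealM; [exact: ideal_EL|exact: eg_ideal].
have vw i : v i \o eg_val (w i) = x i \o u.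
  by rewrite -[LHS]compA eg_valK -[LHS]compA idemP.
have wy i : eg_val (w i)^-1%g \o (x i \o u) = u.
  by rewrite -{1}(eg_idemr (w i)^-1%g) -[LHS]compA -wE eg_valK.
have vv i : v i \o v i = v i.
  rewrite -[LHS]compA (compA (eg_val _)) wy /v.
  by congr (_ \o _); exact: (congr1 eg_val (mul1g _)).
have [v0 vv0] := selfmap_ultra_cvg v.
have Iv0 : ideal E v0 by apply: ideal_cvg vv0; apply: filterE.
have Iy0 : ideal E (x0 \o u) by apply: idealM => //; exact: idem_in.
have [a aE] := eg_of_ideal Iv0; have [z zE] := eg_of_ideal Iy0.
have wz : w @ F --> (a^-1 * z)%g.
  apply: (tau_cvg_division _ vv0 _ aE zE) => [i|]; first exact: ideal_EL.
  by have -> : (fun i => v i \o eg_val (w i) : selfmap P) = (fun i => x i \o u)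
    by apply/funext => i; exact: vw.
have uxu (y : selfmap P) (p : G) : EL y -> eg_val p = u \o (y \o u) -> f_uM p = fhat y.
  move=> ELy pE; rewrite /f_uM pE fhatM//; last first.
    by apply: ideal_EL; apply: idealM => //; exact: idem_in.
  by rewrite fhatM// fhat_idem mul1g mulg1.
have : B (f_uM (a^-1 * z)%g).
  apply: (closed_cvg_ultra (F := F) _ Bcl _ wz).
  by apply: filterS FB => i; rewrite /= (uxu _ _ (ELx i) (wE i)).
have fa : f_uM a = 1%g.
  rewrite /f_uM aE fhatM//; last exact: ideal_EL Iv0.
  rewrite fhat_idem mul1g (fhat_limit_idempotents FU _ vv vv0) //.
  by move=> i; exact: ideal_EL (Iv i).
by rewrite f_uMM f_uMV fa invg1 mul1g (uxu _ _ ELx0 zE).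
Qed.

Definition tp_of (m : small_model P) (s : aut C') : tpspace (sm_emb m).
Proof.
exists (tp (s \o sm_emb m) (sm_emb m)); exists (s \o sm_emb m) => // phi.
by rewrite -aut_sat.
Defined.

Lemma gal_of_tp_of (m : small_model P) (s : aut C') :
  gal_of_type (tp_of m s) = \pi_(galL P) s.
Proof. exact: gal_of_typeE. Qed.

Lemma gal_closedE (m : small_model P) (B : set (galL_top m)) :
  closed B = closed (@gal_of_type _ _ P m @^-1` B).
Proof.
have E1 (T' : topologicalType) (A : set T') : closed A = open (~` A).
  by rewrite -closedC setCK.
by rewrite !E1.
Qed.

(** In the limit pair, [t] has trivial class and [v] has class [f_uM b], while [t^-1 v] realizes the
    limit of the types over [m]. *)
Lemma f_uM_closed_preimage (m : small_model P) (B : set (galL_top m)) :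
  closed B -> closed [set p : G | B (f_uM p)].
Proof.
rewrite gal_closedE => Bcl; apply: closed_ultra => F b FU FB Fb.
have [s sE] := choice (fun x : G => @tp_realized _ _ _ (cmodel P) (pi0 (eg_val x))).
have [t [v [tE vE tv]]] := tau_limit_pair (sm_emb m) FU (sm_small m) Fb sE.
have Et : \pi_(galL P) t = 1%g by rewrite -(fhatE tE) fhat_idem.
have Ev : f_uM b = \pi_(galL P) v by apply: fhatE.
have : B (gal_of_type (tp_of m (t^-1 * v)%g)).
  apply: (closed_cvg_ultra (F := F) (f := fun x => tp_of m (s x)) _ Bcl).
    by apply: filterS FB => x; rewrite /= gal_of_tp_of /f_uM (fhatE (sE x)).
  apply: tp_cvg => phi /= H.
  (* [tp] lists the moved tuple first, the limit pair lists it second. *)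
  pose h (z : m + m) : m + m := match z with inl x => inr x | inr x => inl x end.
  have hE (a a' : m -> C') : sum_val a a' = sum_val a' a \o h.
    by apply/funext => -[].
  have : sat (sum_val (t \o sm_emb m) (v \o sm_emb m)) (rename h phi).
    rewrite sat_rename -hE; move: H; rewrite /tp /= (aut_sat t).
    suff -> : t \o sum_val ((t^-1 * v)%g \o sm_emb m) (sm_emb m) =
      sum_val (v \o sm_emb m) (t \o sm_emb m) by [].
    by apply/funext => -[x|x] //=; exact: (aut_invK t).
  rewrite tv; apply: filterS => x /=.
  by rewrite sat_rename -hE.
rewrite gal_of_tp_of pi_galM /= Ev.
by rewrite pi_galV Et invg1 mul1g.
Qed.

(* The orbit of tp(c/C) is dense, by saturation and homogeneity of C. *)
Lemma orbit_dense (s : aut C') (phi : formula L (C + C)) :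
  tp (s \o c) c phi -> exists g : aut C, tp_set (act g (tp_refl c)) phi.
Proof.
have Cm := mC_monster P.
have [J [h [psi phiE]]] := formula_support phi; rewrite phiE /tp /= sat_rename.
have JK : card_lt J (degC P).
  by apply: (card_lt_le enum_rank_inj); apply: card_lt_fin; exact: monster_limit Cm.
pose isr (k : J) := if h k is inr _ then true else false.
have [x1 x1E] : exists x1 : {k | ~~ isr k} -> C, forall k, h (val k) = inl (x1 k).
  have H (k : {k | ~~ isr k}) : exists x, h (val k) = inl x.
    by case: k => k /=; rewrite /isr; case: (h k) => // x _; exists x.
  by have [x1 ?] := choice H; exists x1.
have [x2 x2E] : exists x2 : {k | isr k} -> C, forall k, h (val k) = inr (x2 k).
  have H (k : {k | isr k}) : exists x, h (val k) = inr x.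
    by case: k => k /=; rewrite /isr; case: (h k) => // x _; exists x.
  by have [x2 ?] := choice H; exists x2.
set t := _ \o h => tpsi.
have FU := principal_filter_ultra tt.
(* With a principal ultrafilter, this copies the finitely many relevant entries into C while keeping
   the parameters in place. *)
have [|a [aE ax]] := @realize_ultra L unit J _ _ (principal_filter tt)
    (fun=> C') (fun=> t) C val x2 FU (monster_sat Cm) JK.
  move=> theta; rewrite ultra_const (emb_sat c).
  suff -> : c \o x2 = t \o val by [].
  by apply/funext => k; rewrite /t /= x2E.
have aP theta : sat a theta <-> sat t theta by rewrite aE; exact: ultra_const.
have [||g gE] := @homogeneous_tuple L (degC P) _ C x1 (a \o val) (monster_hom Cm).
- by apply: card_lt_le JK; exact: val_inj.
- move=> theta; rewrite -[X in _ <-> X]sat_rename aP sat_rename (emb_sat c) (aut_sat s).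
  suff -> : s \o (c \o x1) = t \o val by [].
  by apply/funext => k; rewrite /t /= x1E.
have [g' g'E] := aut_extend g.
have gP : tp (g' \o c) c = tp_set (act g (tp_refl c)).
  exact: (tp_act (s := 1%g) g'E).
exists g; suff : tp_set (act g (tp_refl c)) (rename h psi) by [].
rewrite -gP /tp /= sat_rename.
suff -> : sum_val (g' \o c) c \o h = c \o a.
  by rewrite -emb_sat aP.
apply/funext => k /=; case: (boolP (isr k)) => kr.
  rewrite (x2E (Sub k kr)) /=.
  by rewrite -[a k]/((a \o val) (Sub k kr : {k | isr k})) ax.
rewrite (x1E (Sub k kr)) /= -[a k]/((a \o val) (Sub k kr : {k | ~~ isr k})) -gE.
exact: g'E.
Qed.

Lemma tp_And (N : structure L) A (e : A -> N) (p : tpspace e) phi psi :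
  tp_set p (And phi psi) <-> tp_set p phi /\ tp_set p psi.
Proof. by have [a _ ->] := tp_setP p; exact: sat_And. Qed.

(** By density of the orbit, the formulas of the type define a base of nonempty sets of
    automorphisms; a limit of these in the Ellis semigroup has the required value. *)
Lemma pi0_surj (s : aut C') :
  exists x : selfmap P, EL x /\ tp (s \o c) c = tp_set (pi0 x).
Proof.
have [||phi /orbit_dense//|F [FU FB]] := @ultra_base (aut C) (formula L (C + C))
    (tp (s \o c) c) (fun phi => [set g | tp_set (act g (tp_refl c)) phi]).
- by exists (Imp Bot Bot).
- move=> p q sp sq; exists (And p q); first exact/sat_And.
  by move=> g /tp_And.
have [x Fx] := selfmap_ultra_cvg (act : aut C -> selfmap P).
exists x; split.
  by apply: EL_cvg Fx; apply: filterE => g; apply: subset_closure; exists g.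
have H phi : tp (s \o c) c phi -> tp_set (pi0 x) phi.
  by move=> /FB ?; apply/((selfmap_cvgP _ _).1 Fx).
apply/seteqP; split=> // phi xphi; apply: contrapT => nphi.
by have /tpE := H (Imp phi Bot) nphi.
Qed.

(** A limit class is computed both from types over [m] and from a limit in the Ellis semigroup,
    where [fhat_preimage_cvg] applies. *)
Lemma f_uM_preimage_closed (m : small_model P) (B : set (galL_top m)) :
  closed [set p : G | B (f_uM p)] -> closed B.
Proof.
rewrite gal_closedE => Bcl; apply: closed_ultra => F p FU FB Fp.
have [s sE] := choice (@tp_realized _ _ _ m).
have [x xE] := choice (fun q : tpspace (sm_emb m) => pi0_surj (s q)).
(* The model [m] and [c] are moved by the same automorphisms, so a single [r] describes both
   limits. *)
pose e : m + C -> C' := sum_val (sm_emb m) c.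
have eK : card_lt (m + C) K by apply: card_lt_sum => //; exact: sm_small.
have [b bE] := realize_over (fun q => s q \o e) e eK eK.
have bX (Y : Type) (h : Y -> (m + C) + (m + C)) w (a : _ -> Y -> C') (phi : formula L Y) :
    w = sum_val b e \o h -> (forall q, a q = sum_val (s q \o e) e \o h) ->
    sat w phi <-> F [set q | sat (a q) phi].
  move=> -> aE; rewrite -sat_rename bE.
  by under eq_set do rewrite (propext (sat_rename _ _ _)) -aE.
have [r rE] : exists r : aut C', r \o e = b.
  apply: aut_of_type => // phi.
  rewrite (bX _ inl b (fun q => s q \o e))//.
  under eq_set do rewrite -(propext (aut_sat _ _ _)).
  by apply: iff_sym; exact: ultra_const.
have Ep : @gal_of_type _ _ P m p = \pi_(galL P) r.
  apply: gal_of_typeE; apply/seteqP.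
  suff H phi : tp (r \o sm_emb m) (sm_emb m) phi <-> tp_set p phi by split=> phi /H.
  rewrite (tp_cvgP phi Fp).
  pose h (z : m + m) : (m + C) + (m + C) :=
    match z with inl x => inl (inl x) | inr x => inr (inl x) end.
  rewrite /tp /= (bX _ h _ (fun q => sum_val (s q \o sm_emb m) (sm_emb m))).
  - suff -> : [set q | sat (sum_val (s q \o sm_emb m) (sm_emb m)) phi] =
      [set q | tp_set q phi] by [].
    by apply/funext => q; exact: (congr1 (fun S => S phi) (sE q)).
  - by apply/funext => -[z|z] //=; rewrite -rE.
  - by move=> q; apply/funext => -[z|z].
suff : B (\pi_(galL P) r) by rewrite -Ep.
have [x0 xx0] := selfmap_ultra_cvg x.
have <- : fhat x0 = \pi_(galL P) r.
  apply: fhatE; apply/seteqP.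
  suff H phi : tp (r \o c) c phi <-> tp_set (pi0 x0) phi by split=> phi /H.
  rewrite ((selfmap_cvgP _ _).1 xx0).
  pose h (z : C + C) : (m + C) + (m + C) :=
    match z with inl x => inl (inr x) | inr x => inr (inr x) end.
  rewrite /tp /= (bX _ h _ (fun q => sum_val (s q \o c) c)).
  - suff -> : [set q | sat (sum_val (s q \o c) c) phi] =
      [set q | tp_set (x q (tp_refl c)) phi] by [].
    by apply/funext => q; exact: (congr1 (fun S => S phi) (xE q).2).
  - by apply/funext => -[z|z] //=; rewrite -rE.
  - by move=> q; apply/funext => -[z|z].
apply: (fhat_preimage_cvg FU Bcl _ _ xx0) => [q|]; first exact: (xE q).1.
by apply: filterS FB => q; rewrite /= (fhatE (xE q).2) (gal_of_typeE (sE q)).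
Qed.

End galois.

(** * The quotient by [H(uM)] *)

Lemma cvg_ultra (T U : topologicalType) (f : T -> U) (x : T) (y : U) :
  (forall F, UltraFilter F -> id @ F --> x -> f @ F --> y) -> f @ x --> y.
Proof.
move=> H V yV; apply: contrapT => nV.
have [| | |F [FU FB]] := @ultra_base T (set T) (nbhs x) (fun W => W `&` ~` (f @^-1` V)).
- by exists setT; exact: (@filterT _ _ (nbhs_filter x)).
- move=> W W' xW xW'; exists (W `&` W'); first exact: (@filterI _ _ (nbhs_filter x)).
  by move=> z [[Wz W'z] nVz]; split.
- move=> W xW; apply: contrapT => /forallNP n; apply: nV.
  apply: (@filterS _ _ (nbhs_filter x) W) => // z Wz; apply: contrapT => nVz.
  by apply: (n z).
have Fx : id @ F --> x.
  by move=> W /FB FW; suff : F W by []; apply: filterS FW => z [].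
have FV : F (f @^-1` V) by exact: (H F FU Fx V yV).
have FnV : F (~` (f @^-1` V)).
  have FT := FB _ (@filterT _ _ (nbhs_filter x)).
  by apply: filterS FT => z [].
by have [z []] := filter_ex (filterI FV FnV).
Qed.

Lemma cvg_set_type (X : topologicalType) (A : set X) (F : set_system A) (p : A) :
  Filter F -> set_val @ F --> set_val p -> F --> p.
Proof.
move=> FF Fp U [_ [[B Bop <-] Bp sBU]].
have FB : F (set_val @^-1` B) by apply: Fp; exact: open_nbhs_nbhs.
exact: filterS FB.
Qed.

Lemma set_val_continuous (X : topologicalType) (A : set X) :
  continuous (set_val : A -> X).
Proof. exact: initial_continuous. Qed.

Lemma closed_compact_hausdorff_group (G : TGroup.type) (K : set G) :
  compact [set: G] -> hausdorff_space G ->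
  continuous (fun z : G * G => (z.1 * z.2)%g) -> continuous (fun z : G => z^-1%g) ->
  subgroup K -> closed K -> compact_hausdorff_group K.
Proof.
move=> Gcpt Gh Mc Vc Ksub Kcl; split=> //.
- rewrite compact_ultra => F FU _.
  have : compact [set: G] by []; rewrite compact_ultra => /(_ (set_val @ F)).
  case=> [||p [_ Fp]]; [exact: ultra_fmap|exact: filterT|].
  have Kp : K p.
    apply: (closed_cvg_ultra (F := F) (f := set_val) _ Kcl _ Fp).
    by apply: filterE => k; exact: set_valP.
  exists (SigSub (mem_set Kp)); split=> //.
  by apply: cvg_set_type.
- move=> p q pq; apply/val_inj/Gh => U V pU qV.
  have [k [Uk Vk]] := pq _ _ (set_val_continuous pU) (set_val_continuous qV).
  by exists (set_val k).
- move=> [p q].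
  apply: (@cvg_comp _ _ _ (fun z : K * K => (val z.1, val z.2))
    (fun z : G * G => (z.1 * z.2)%g) _ (nbhs (val p, val q))); last exact: (Mc (val p, val q)).
  apply: cvg_pair => /=.
    apply: (@cvg_comp _ _ _ fst (set_val : K -> G) _ (nbhs p)); first exact: cvg_fst.
    exact: set_val_continuous.
  apply: (@cvg_comp _ _ _ snd (set_val : K -> G) _ (nbhs q)); first exact: cvg_snd.
  exact: set_val_continuous.
- move=> p; apply: (@continuous_comp _ _ _ (set_val : K -> G) (fun z : G => z^-1%g)).
    exact: set_val_continuous.
  exact: Vc.
Qed.

Lemma closure_subgroup (G : TGroup.type) (Y : set G) :
  continuous (fun z : G * G => (z.1 * z.2)%g) -> continuous (fun z : G => z^-1%g) ->
  subgroup Y -> subgroup (closure Y).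
Proof.
move=> Mc Vc [Y1 YM YV]; split; first exact: subset_closure.
- move=> x y clx cly U /(Mc (x, y))[[V W] /= [xV yW] VWU].
  have [x' [Yx' Vx']] := clx _ xV; have [y' [Yy' Wy']] := cly _ yW.
  by exists (x' * y')%g; split; [exact: YM|exact: (VWU (x', y'))].
- move=> x clx U /Vc/clx[x' [Yx' Ux']].
  by exists x'^-1%g; split; [exact: YV|].
Qed.

(** * Kernels and induced isomorphisms *)

Section induced.
Context {G Q : groupType} (f : G -> Q).
Local Open Scope group_scope.
Hypothesis fM : forall x y, f (x * y) = f x * f y.

Lemma morph1 : f 1 = 1.
Proof. by apply: (@mulgI _ (f 1)); rewrite -fM !mulg1. Qed.

Lemma morphV x : f x^-1 = (f x)^-1.
Proof. by apply: (@mulgI _ (f x)); rewrite -fM !mulgV morph1. Qed.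

Let Y := [set x | f x = 1].

Lemma kernel_normal : normal Y.
Proof.
split; first split; rewrite /Y /=.
- exact: morph1.
- by move=> x y fx fy; rewrite fM fx fy mulg1.
- by move=> x fx; rewrite morphV fx invg1.
- by move=> g x /= fx; rewrite !fM morphV fx mulg1 mulgV.
Qed.

Lemma coset_kernel x : coset x Y = [set z | f z = f x].
Proof.
apply/seteqP; split=> [_ [y fy <-]|z fz]; first by rewrite /= fM fy mulg1.
by exists (x^-1 * z); [rewrite /Y /= fM morphV fz mulVg|rewrite mulVKg].
Qed.

Lemma kernel_induces_iso (K : set G) : induces_iso f K Y (f @` K).
Proof.
pose phi (S : set G) : Q := xget 1 (f @` S).
have phiE x : phi (coset x Y) = f x.
  rewrite /phi coset_kernel; case: xgetP => [_ _ [z fz <-]|/(_ (f x)) []] //.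
  by exists x.
exists phi; split=> [x _|| x y _ _]; first exact: phiE.
  split=> [_ [x Kx <-]||_ [x Kx <-]].
  - by rewrite phiE; exists x.
  - move=> _ _ /set_mem[x _ <-] /set_mem[y _ <-]; rewrite !phiE !coset_kernel.
    by move=> ->.
  - by exists (coset x Y); [exists x|exact: phiE].
have -> : setM (coset x Y) (coset y Y) = coset (x * y) Y.
  rewrite !coset_kernel; apply/seteqP; split=> [_ [a fa [b fb <-]]|z /= fz].
    by rewrite /= !fM fa fb.
  by exists x => //; exists (x^-1 * z); rewrite /= ?mulVKg// fM fz morphV fM mulKg.
by rewrite !phiE fM.
Qed.

End induced.

Section ellis_quotient.
Context {L : language} {T : theory L} {P : monster_pair T} (E : ellis_data P).

Notation G := (ellis_group E).
Notation Q := (ellis_quotient E).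
Notation H_uM_set := (@Defs.H_uM_set L T P E).
Local Open Scope group_scope.

Lemma pi_ellisM (x y : G) : \pi_Q (x * y) = \pi_Q x * \pi_Q y.
Proof. by rewrite -[RHS]/(quotM _ _) piM. Qed.

Lemma pi_ellis_eq (x y : G) : \pi_Q x = \pi_Q y <-> H_uM_set (x^-1 * y).
Proof. exact: quot_eqP. Qed.

Lemma pi_ellis_continuous : continuous (\pi_Q : G -> Q).
Proof. by apply/continuousP. Qed.

Lemma ellis_quotient_cvgM (I : Type) (F : set_system I) (x y : I -> Q) :
  UltraFilter F -> exists a b : Q,
  [/\ x @ F --> a, y @ F --> b & (fun i => x i * y i) @ F --> a * b].
Proof.
move=> FU; have [a [b [xa yb xyab]]] := tau_cvgM (fun i => repr (x i)) (fun i => repr (y i)).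
have piF (z : I -> G) (t : G) : z @ F --> t -> (fun i => \pi_Q (z i)) @ F --> \pi_Q t.
  move=> zt; exact: (@cvg_comp _ _ _ z (\pi_Q : G -> Q) F (nbhs t) _ zt
    (@pi_ellis_continuous t)).
have rE (z : I -> Q) : (fun i => \pi_Q (repr (z i))) = z.
  by apply/funext => i; exact: reprK.
exists (\pi_Q a), (\pi_Q b); split.
- by have := piF _ _ xa; rewrite rE.
- by have := piF _ _ yb; rewrite rE.
- rewrite -pi_ellisM; have := piF _ _ xyab.
  suff -> : (fun i => \pi_Q (repr (x i) * repr (y i))) = (fun i => x i * y i) by [].
  by apply/funext => i; rewrite pi_ellisM !reprK.
Qed.

Lemma ellis_quotient_compact : compact [set: Q].
Proof.
rewrite compact_ultra => F FU _.
by have [a [_ [Fa _ _]]] := @ellis_quotient_cvgM _ F id id FU; exists a.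
Qed.

(** The saturation of [U] is a union of right translates of [U], which are open. *)
Lemma pi_ellis_open (U : set G) : open U -> open (\pi_Q @` U).
Proof.
move=> oU; suff : open (\pi_Q @^-1` (\pi_Q @` U)) by [].
have -> : \pi_Q @^-1` (\pi_Q @` U) = \bigcup_(h in H_uM_set) [set x | U (x * h)].
  apply/seteqP; split=> [x [y Uy /esym/pi_ellis_eq xy]|x [h Hh Uxh]].
    by exists (x^-1 * y) => //=; rewrite mulVKg.
  exists (x * h) => //; apply/esym/pi_ellis_eq; by rewrite mulKg.
by apply: bigcup_open => h _; exact: open_mulr.
Qed.

Lemma H_uM_closed : closed H_uM_set.
Proof. by apply: closed_bigI => V _; exact: closed_closure. Qed.

(** Inseparable classes yield an ultrafilter on pairs [(x, h)], with [h] in [H_uM_set], along which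
    [x] tends to [a] and [x h] to [b]. Compatible limits [a'], [h'] and their product agree with
    these up to [H_uM_set], which is closed and so contains [h']. *)
Lemma ellis_quotient_hausdorff : hausdorff_space Q.
Proof.
have [[H1 HM HV] _] := H_uM_normal E.
move=> p q pq; rewrite -[p]reprK -[q]reprK; apply/pi_ellis_eq.
set a := repr p; set b := repr q.
have [|V V' [oV Va oU Ub] [oV' V'a oU' U'b]||F [FU FB]] :=
    @ultra_base (G * G) (set G * set G)
      [set z | [/\ open z.1, z.1 a, open z.2 & z.2 b]]
      (fun z => [set xh | [/\ z.1 xh.1, H_uM_set xh.2 & z.2 (xh.1 * xh.2)]]).
- by exists (setT, setT); split=> //; exact: openT.
- exists (V.1 `&` V'.1, V.2 `&` V'.2); first by split=> //; exact: openI.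
  by move=> xh [[? ?] ? [? ?]].
- move=> [V U] [/= oV Va oU Ub].
  have pV : nbhs p (\pi_Q @` V).
    apply: open_nbhs_nbhs; split; first exact: pi_ellis_open.
    by exists a => //; exact: reprK.
  have qU : nbhs q (\pi_Q @` U).
    apply: open_nbhs_nbhs; split; first exact: pi_ellis_open.
    by exists b => //; exact: reprK.
  have [_ [[v Vv <-] [w Uw /esym/pi_ellis_eq vw]]] := pq _ _ pV qU.
  by exists (v, v^-1 * w); split=> //=; rewrite mulVKg.
have Fa : fst @ F --> a.
  move=> V; rewrite nbhsE => -[V' [oV' V'a] V'V].
  have FV : F (fst @^-1` V).
    apply: filterS (FB (V', setT) _) => [xh [/= ? _ _]|]; first exact: V'V.
    by split=> //; exact: openT.
  exact: FV.
have Fb : (fun xh => xh.1 * xh.2) @ F --> b.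
  move=> V; rewrite nbhsE => -[V' [oV' V'a] V'V].
  have FV : F ((fun xh => xh.1 * xh.2) @^-1` V).
    apply: filterS (FB (setT, V') _) => [xh [/= _ _ ?]|]; first exact: V'V.
    by split=> //; exact: openT.
  exact: FV.
have FH : F (snd @^-1` H_uM_set).
  apply: filterS (FB (setT, setT) _) => [xh [/= _ ? _]//|].
  by split=> //; exact: openT.
have [a' [h' [Fa' Fh' Fah']]] := tau_cvgM (F := F) fst snd.
have Hh' : H_uM_set h' by exact: (closed_cvg_ultra _ H_uM_closed FH Fh').
have aa' : H_uM_set (a^-1 * a') by exact: tau_cvg_H Fa Fa'.
have bb' : H_uM_set ((a' * h')^-1 * b) by exact: tau_cvg_H Fah' Fb.
have := HM _ _ (HM _ _ aa' Hh') bb'.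
by rewrite invgM -!mulgA mulVKg mulVKg.
Qed.

Lemma ultra_lim_unique (I : Type) (F : set_system I) (x : I -> Q) (a b : Q) :
  UltraFilter F -> x @ F --> a -> x @ F --> b -> a = b.
Proof.
move=> FU xa xb; apply: ellis_quotient_hausdorff => U V /xa aU /xb bV.
by have [i [Ui Vi]] := filter_ex (filterI aU bV); exists i.
Qed.

(** Every ultrafilter has limits compatible with the product, and limits are now unique. *)
Lemma ellis_quotient_mul_continuous : continuous (fun z : Q * Q => z.1 * z.2).
Proof.
move=> [a b]; apply: cvg_ultra => F FU Fab.
have [a' [b' [Fa' Fb' Fab']]] := ellis_quotient_cvgM fst snd FU.
have Fa : fst @ F --> a by exact: (@cvg_comp _ _ _ id fst F (nbhs (a, b)) _ Fab cvg_fst).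
have Fb : snd @ F --> b by exact: (@cvg_comp _ _ _ id snd F (nbhs (a, b)) _ Fab cvg_snd).
by rewrite /= (ultra_lim_unique FU Fa Fa') (ultra_lim_unique FU Fb Fb').
Qed.

(** The compatible limits of [z] and [z^-1] multiply to the limit of the constant 1. *)
Lemma ellis_quotient_inv_continuous : continuous (fun z : Q => z^-1).
Proof.
move=> a; apply: cvg_ultra => F FU Fa.
have [a' [b [Fa' Fb Fab]]] := ellis_quotient_cvgM id (fun z : Q => z^-1) FU.
suff -> : a^-1 = b by [].
have F1 : (fun z : Q => z * z^-1) @ F --> (1 : Q).
  suff -> : (fun z : Q => z * z^-1) = (fun=> 1) by exact: cvg_cst.
  by apply/funext => z; rewrite mulgV.
have /esym ab := ultra_lim_unique FU Fab F1.
rewrite -(ultra_lim_unique FU Fa Fa') in ab.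
by apply: (@mulgI _ a); rewrite mulgV ab.
Qed.

Lemma fbar_pi (x : G) : fbar (\pi_Q x) = f_uM x.
Proof.
rewrite /fbar; have /pi_ellis_eq/f_uM_H : \pi_Q (repr (\pi_Q x)) = \pi_Q x by rewrite reprK.
set y := repr _; rewrite f_uMM f_uMV => yx.
by apply: (@mulgI _ (f_uM y)^-1); rewrite yx mulVg.
Qed.

Lemma fbarM (x y : Q) : fbar (x * y) = fbar x * fbar y.
Proof.
rewrite -[x in LHS]reprK -[y in LHS]reprK -pi_ellisM fbar_pi.
exact: f_uMM.
Qed.

Lemma fbar_closed_preimage (m : small_model P) (B : set (galL_top m)) :
  closed B <-> closed (@fbar _ _ _ E @^-1` B).
Proof.
have E1 (T' : topologicalType) (A : set T') : closed A = open (~` A).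
  by rewrite -closedC setCK.
have -> : closed (@fbar _ _ _ E @^-1` B) = closed [set p : G | B (f_uM p)].
  rewrite E1 [in RHS]E1.
  rewrite -[LHS]/(open (\pi_Q @^-1` (~` (@fbar _ _ _ E @^-1` B)))).
  congr open; apply/funext => x; rewrite /= /setC /preimage /=.
  by rewrite (fbar_pi x).
by split; [exact: f_uM_closed_preimage|exact: f_uM_preimage_closed].
Qed.

End ellis_quotient.

(** * The closure of the kernel and its image *)

Theorem theorem3p9 (L : language) (T : theory L) (Tcomplete : complete_theory T)
  (P : monster_pair T) (E : ellis_data P) (m : small_model P) :
  let Y : set (ellis_quotient E) := [set x | fbar x = 1%g] in
  let clY : set (ellis_quotient E) := closure Y in
  [/\ compact_hausdorff_group clY,
      normal Y /\ dense ((set_val : clY -> _) @^-1` Y),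
      @fbar _ _ _ E @` clY = gal0 m
    & induces_iso (@fbar _ _ _ E) clY Y (gal0 m)].
Proof.
move=> Y clY.
have Mc := @ellis_quotient_mul_continuous _ _ _ E.
have Vc := @ellis_quotient_inv_continuous _ _ _ E.
have Ynormal : normal Y by apply: kernel_normal; exact: fbarM.
have [clY1 clYM clYV] : subgroup clY by apply: closure_subgroup => //; case: Ynormal.
have YclY : Y `<=` clY by exact: subset_closure.
have image : @fbar _ _ _ E @` clY = gal0 m.
  apply/seteqP; split=> [_ [x clYx <-]|].
    have H : closed (@fbar _ _ _ E @^-1` gal0 m).
      by apply/fbar_closed_preimage; exact: closed_closure.
    apply: (H x); apply: closureS clYx => y /= ->; exact: subset_closure.
  (* [clY] is a subgroup containing the kernel, hence a union of cosets of it. *)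
  have preimage_image : @fbar _ _ _ E @^-1` (@fbar _ _ _ E @` clY) = clY.
    apply/seteqP; split=> [x [y clYy yx]|x clYx]; last by exists x.
    have -> : x = (y * (y^-1 * x))%g by rewrite mulVKg.
    apply: clYM => //; apply: YclY; rewrite /Y /=.
    by rewrite fbarM (morphV (@fbarM _ _ _ E)) yx mulVg.
  have clYcl : closed (@fbar _ _ _ E @^-1` (@fbar _ _ _ E @` clY)).
    by rewrite preimage_image; exact: closed_closure.
  have H : closed (@fbar _ _ _ E @` clY : set (galL_top m)).
    by apply/fbar_closed_preimage; exact: clYcl.
  (* The image is a closed set containing 1, so it contains the closure of 1. *)
  move=> b b0; apply: (H b); apply: closureS b0 => _ ->.
  by exists 1%g => //; exact: (morph1 (@fbarM _ _ _ E)).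
split=> //.
- apply: closed_compact_hausdorff_group => //.
  + exact: ellis_quotient_compact.
  + exact: ellis_quotient_hausdorff.
  + exact: closed_closure.
- split=> // O [[x xY] Ox] [B Bop BO].
  have clx : clY x by exact: set_mem.
  have xB : B x by move: Ox; rewrite -BO.
  have [y [Yy By]] := clx _ (open_nbhs_nbhs (conj Bop xB)).
  exists (SigSub (mem_set (YclY _ Yy))); split=> //.
  by rewrite -BO.
- rewrite -image; apply: kernel_induces_iso; exact: fbarM.
Qed.
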